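(* Let $Q$ be an $F$-path with $\mathrm{ht}(Q)=k$, and let $Q=Q_1\oplus Q_2\oplus\cdots\oplus Q_{k+1}$, where each $Q_i$ is an $F$-path with $\mathrm{ht}(Q_i)=0$ for $1\le i\le k+1$. Then, for any ${\rm A}\in\{{\rm P,B,S,I,J,T}\}$, $$\psi_{\rm A}(Q)=\psi_{\rm A}(Q_1)\oplus\psi_{\rm A}(Q_2)\oplus\cdots\oplus\psi_{\rm A}(Q_{k+1}).$$
   Context: **$F$-paths.** $F=\{(a,b)\in\mathbb{Z}^2 : a\ge 1,\ b\le 1\}\cup\{(0,1)\}$. $\mathcal{F}_n$ is the set of $F$-paths of length $n\ge0$: sequences of $n$ steps $s_1\cdots s_n$ in $F$ starting at $(0,0)$ such that each $(x_i,y_i)=s_1+\cdots+s_i$ has $x_i\le y_i$. $\mathrm{ht}(Q)=y_n-x_n$. Direct sum: $Q_1\oplus Q_2=Q_1(0,1)Q_2$. An $F$-path of height $k$ can be uniquely written $Q_1(0,1)Q_2(0,1)\cdots(0,1)Q_{k+1}$ with all $\mathrm{ht}(Q_i)=0$ (the $Q_i$ may be empty). Iterated direct sums are read from left to right. **(P) Schröder paths.** $\mathcal{P}_n$: lattice paths from $(0,0)$ to $(2n,0)$ not going below the $x$-axis, with steps $u=(1,1)$, $d=(1,-1)$, $h=(2,0)$, and no three consecutive steps $ddd$. $\mathrm{hox}(P)$ is the number of $h$ steps on the $x$-axis. Direct sum: $P_1\oplus P_2=P_1hP_2$. The bijection $\psi_{\rm P}:\mathcal{F}_n\to\mathcal{P}_n$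 (which satisfies $\mathrm{hox}(\psi_{\rm P}(Q))=\mathrm{ht}(Q)$) is recursive: $\psi_{\rm P}(\emptyset)=\emptyset$; for $Q=\hat Qs$ with $P'=\psi_{\rm P}(\hat Q)$ and $k,j\ge0$: if $s=(0,1)$ then $\psi_{\rm P}(Q)=P'h$; if $s=(1,1)$ then $P'ud$; if $s=(k+2,1)$, write $P'=XhY$ with $\mathrm{hox}(Y)=k$ and set $\psi_{\rm P}(Q)=XuYhd$; if $s=(1,-j)$, write $P'=XhZ$ with $\mathrm{hox}(Z)=j$ and set $\psi_{\rm P}(Q)=XuZudd$; if $s=(k+2,-j)$, write $P'=XhYhZ$ with $\mathrm{hox}(Y)=k$, $\mathrm{hox}(Z)=j$ and set $\psi_{\rm P}(Q)=XuYuZhdd$ (here $X,Y,Z$ are Schröder paths, the displayed $h$ in $P'$ being on the $x$-axis). **(B) Restricted bicolored Dyck paths.** $\mathcal{B}_n$ ($n\ge1$): Dyck paths with $n$ up steps whose down steps are colored black ($d_{\rm b}$) or red ($d_{\rm r}$), of the form $B=u^{i_1}d_{\rm r}^{j_1}d_{\rm b}^{k_1}\cdots u^{i_{\ell-1}}d_{\rm r}^{j_{\ell-1}}d_{\rm b}^{k_{\ell-1}}u^{i_\ell}d_{\rm r}^{j_\ell}$ with $\ell\ge1$, $i_m,k_m\ge1$, $j_m\ge0$; $\mathrm{last}(B)=j_\ell$. Direct sum: $B_1\oplus B_2=\overline{B_1}B_2d_{\rm r}^{\mathrm{last}(B_1)}$, where $\overline{B_1}$ is $B_1$ with its final run $d_{\rm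 r}^{\mathrm{last}(B_1)}$ removed. The bijection $\psi_{\rm B}:\mathcal{F}_n\to\mathcal{B}_{n+1}$ sends $(a_1,b_1)\cdots(a_n,b_n)$ to $B_1\cdots B_n\,u\,d_{\rm r}^{t}$ with $B_i=u\,d_{\rm r}^{1-b_i}d_{\rm b}^{a_i}$ and $t$ determined by the path ending on the $x$-axis. **(S) Permutations.** $\mathcal{S}_n$: permutations of $\{1,\dots,n\}$ avoiding $2341,2431,3241$. Direct sum for $\pi\in\mathfrak{S}_n,\sigma\in\mathfrak{S}_m$: $(\pi\oplus\sigma)(i)=\pi(i)$ for $i\le n$ and $\sigma(i-n)+n$ for $n<i\le n+m$. $\mathrm{block}(\pi)$ is the number of indecomposable direct summands of $\pi$ ($0$ for the empty permutation); $|\sigma|$ is the length of $\sigma$. The bijection $\psi_{\rm S}:\mathcal{F}_n\to\mathcal{S}_{n+1}$ (which satisfies $\mathrm{block}(\psi_{\rm S}(Q))=\mathrm{ht}(Q)+1$) is recursive: $\psi_{\rm S}(\emptyset)=1$; for $Q=\hat Qs\in\mathcal{F}_n$, $\hat\pi=\psi_{\rm S}(\hat Q)\in\mathcal{S}_n$, $\pi=\psi_{\rm S}(Q)$ and $k,j\ge0$: - $s=(0,1)$: $\pi=\hat\pi\oplus1$. - $s=(1,1-j)$: write $\hat\pi=\sigma\oplus\tau$ with $\mathrm{block}(\tau)=j+1$ ($\sigma$ possibly empty), $x=|\sigma|+1$; $\pi(i)=\hat\pi(i)$ for $i<x$, $\pi(x)=n+1$, $\pi(i)=\hat\pi(i-1)$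 for $i>x$. - $s=(k+2,1)$: write $\hat\pi=\sigma\oplus\omega$ with $\mathrm{block}(\omega)=k+1$, $x=|\sigma|+1\geq 2$, $y=\hat\pi^{-1}(x-1)$; $\pi(i)=\hat\pi(i)$ for $i<x$, $i\ne y$; $\pi(y)=n$; $\pi(x)=n+1$; $\pi(i)=\hat\pi(i-1)-1$ for $i>x$. - $s=(k+2,-j)$: write $\hat\pi=\sigma\oplus\omega\oplus\tau$ with $\mathrm{block}(\omega)=k+1$, $\mathrm{block}(\tau)=j+1$, $x=|\sigma|+1\ge2$, $z=|\sigma|+|\omega|$, $y=\hat\pi^{-1}(x-1)$; $\pi(i)=\hat\pi(i)$ for $i<x$, $i\ne y$; $\pi(y)=z$; $\pi(x)=n+1$; $\pi(i)=\hat\pi(i-1)-1$ for $x+1\le i\le z+1$; $\pi(i)=\hat\pi(i-1)$ for $z+2\le i\le n+1$. **(I) $(101,102)$-avoiding inversion sequences.** An inversion sequence of length $n$ is $(e_1,\dots,e_n)$ with integers $0\le e_i<i$. $\mathcal{I}_n$ is the set of those with no $i<j<k$ such that $e_j<e_i=e_k$ or $e_j<e_i<e_k$. $\max(e)$ is the largest entry, $\mathrm{prmx}(e)$ the position of its rightmost occurrence, and $\hat e$ is $e$ with the entry at position $\mathrm{prmx}(e)$ deleted. For $e\in\mathcal{I}_n,f\in\mathcal{I}_m$, the direct sum $e\oplus f$ of length $n+m$ has entries $e_i$ for $1\le i\le\mathrm{prmx}(e)$; $f_{i-\mathrm{prmx}(e)}+\max(e)$ for $\mathrm{prmx}(e)<i\le\mathrm{prmx}(e)+m$;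 and $e_{i-m}$ for $i>\mathrm{prmx}(e)+m$. $\psi_{\rm I}:\mathcal{F}_n\to\mathcal{I}_{n+1}$ is the inverse of the bijection $\phi_{\rm I}$ given by $\phi_{\rm I}((0))=\emptyset$ and $\phi_{\rm I}(e)=\phi_{\rm I}(\hat e)\,(\max(e)-\max(\hat e),\ \mathrm{prmx}(e)-\mathrm{prmx}(\hat e))$. **(J) $(101,021)$-avoiding inversion sequences.** $\mathcal{J}_n$ is the set of inversion sequences of length $n$ with no $i<j<k$ such that $e_j<e_i=e_k$ or $e_i<e_k<e_j$. Each $\varepsilon\in\mathcal{J}_{n+1}$ is uniquely of the form $0^{i_0}1^{j_1}0^{i_1}\cdots n^{j_n}0^{i_n}$ with nonnegative exponents such that $j_k=0$ implies $i_k=0$; $\mathrm{first}(\varepsilon)=i_0$. For $\varepsilon\in\mathcal{J}_n,\zeta\in\mathcal{J}_m$, the direct sum $\varepsilon\oplus\zeta$ of length $n+m$ has entries $\zeta_{i-\mathrm{first}(\varepsilon)}$ for $\mathrm{first}(\varepsilon)<i\le\mathrm{first}(\varepsilon)+m$; $\varepsilon_{i-m}+m$ if $i>\mathrm{first}(\varepsilon)+m$ and $\varepsilon_{i-m}>0$; and $0$ otherwise. $\psi_{\rm J}:\mathcal{F}_n\to\mathcal{J}_{n+1}$ is the inverse of the bijection $\phi_{\rm J}$ with $\phi_{\rm J}(0)=\emptyset$ and $\phi_{\rm J}(0^{i_0}1^{a_n}0^{1-b_n}2^{a_{n-1}}0^{1-b_{n-1}}\cdots n^{a_1}0^{1-b_1})=(a_1,b_1)\cdots(a_n,b_n)$.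 **(T) Weighted ordered trees.** An ordered tree is a rooted tree with the children of each vertex linearly ordered; $\deg^+(v)$ is the number of children of $v$; interior vertices are those that are neither the root nor leaves. In a weighted ordered tree each interior vertex $v$ has a weight $\mathrm{wt}(v)\in\{1,\dots,\deg^+(v)\}$. $\mathcal{T}_n$ is the set of weighted ordered trees with $n$ edges. A tree is written $T=(T_1,\dots,T_r)$, where $T_1,\dots,T_r$ are the subtrees at the children of the root, listed from right to left (weights retained). Direct sum: $(T_1,\dots,T_r)\oplus(S_1,\dots,S_q)=(T_1,\dots,T_r,S_1,\dots,S_q)$. $\psi_{\rm T}:\mathcal{F}_n\to\mathcal{T}_{n+1}$ is the inverse of the bijection $\phi_{\rm T}$ which sends the one-edge tree to $\emptyset$ and, for $n\ge1$, sends $T\in\mathcal{T}_{n+1}$ with vertices $v_0,v_1,\dots,v_{n+1}$ in preorder (root first, children visited left to right) to $(a_1,b_1)\cdots(a_n,b_n)$, where $(a_i,b_i)=(\mathrm{wt}(v),\mathrm{wt}(v)-\deg^+(v)+1)$ if $v_{n-i+2}$ is the left-most child of an interior vertex $v$, and $(a_i,b_i)=(0,1)$ otherwise. *)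

(* Defs.v *)
From HB Require Import structures.
From mathcomp Require Import all_boot all_order all_algebra.
From mathcomp Require Import boolp classical_sets functions.
Set Implicit Arguments.
Unset Strict Implicit.
Unset Printing Implicit Defensive.

(* Finite sequences are 0-indexed by [nth] and [take]; the mathematical text
   indexes them from 1. *)

Definition dsums (T : Type) (op : T -> T -> T) (k : nat) (xs : k.+1.-tuple T) :
  T := foldl op (thead xs) (behead xs).

Definition step : Type := (int * int)%type.

Definition inF (s : step) : bool :=
  ((1 <= s.1) && (s.2 <= 1) || (s == (0, 1)))%R.

Definition endpoint (Q : seq step) : step := (\sum_(s <- Q) s)%R.

Definition Fpath (Q : seq step) : bool :=
  all inF Q &&
  all (fun i => ((endpoint (take i Q)).1 <= (endpoint (take i Q)).2)%R)
    (iota 1 (size Q)).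

Definition ht (Q : seq step) : int := ((endpoint Q).2 - (endpoint Q).1)%R.

Definition dsumF (Q1 Q2 : seq step) : seq step := Q1 ++ (0, 1)%R :: Q2.

(* The maps [psiP], [psiB], [psiS], [psiI], [psiJ], [psiT] below are total on
   sequences of steps; their values are meaningful on F-paths only. *)

Variant pstep := Pu | Pd | Ph.

Definition pstep_eqb (s t : pstep) : bool :=
  match s, t with Pu, Pu | Pd, Pd | Ph, Ph => true | _, _ => false end.

Lemma pstep_eqP : Equality.axiom pstep_eqb.
Proof. by do 2!case; constructor. Qed.

HB.instance Definition _ := hasDecEq.Build pstep pstep_eqP.

(* The words XhY and XhYhZ decomposed by [psiP] have no factor ddd, hence
   neither do X, Y and Z; that condition is not repeated here. *)
Definition schroeder (P : seq pstep) : bool :=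
  all (fun i => count_mem Pd (take i P) <= count_mem Pu (take i P))
    (iota 0 (size P)) &&
  (count_mem Pd P == count_mem Pu P).

(* On a Schroeder path, the step of index i starts on the x-axis iff the first
   i steps contain as many u as d. *)
Definition hox (P : seq pstep) : nat :=
  count (fun i => (nth Pu P i == Ph) &&
                  (count_mem Pd (take i P) == count_mem Pu (take i P)))
    (iota 0 (size P)).

Definition dsumP (P1 P2 : seq pstep) : seq pstep := P1 ++ Ph :: P2.

(* [hsplit k P] is the pair (X, Y) with P = XhY, X and Y Schroeder paths (so
   the displayed h is on the x-axis) and hox(Y) = k. *)
Definition hsplit (k : nat) (P : seq pstep) : seq pstep * seq pstep :=
  let i := find (fun i => [&& nth Pu P i == Ph, schroeder (take i P),
                             schroeder (drop i.+1 P) & hox (drop i.+1 P) == k])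
             (iota 0 (size P)) in
  (take i P, drop i.+1 P).

Definition stepP (P : seq pstep) (s : step) : seq pstep :=
  let: (a, b) := s in
  let k := `|a - 2|%N in
  let j := `|b|%N in
  if a == 0%R then P ++ [:: Ph]
  else if (a == 1%R) && (b == 1%R) then P ++ [:: Pu; Pd]
  else if b == 1%R then
    let: (X, Y) := hsplit k P in X ++ Pu :: Y ++ [:: Ph; Pd]
  else if a == 1%R then
    let: (X, Z) := hsplit j P in X ++ Pu :: Z ++ [:: Pu; Pd; Pd]
  else
    let: (W, Z) := hsplit j P in
    let: (X, Y) := hsplit k W in
    X ++ Pu :: Y ++ Pu :: Z ++ [:: Ph; Pd; Pd].

Definition psiP (Q : seq step) : seq pstep := foldl stepP [::] Q.

Variant bstep := Bu | Bb | Br.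

Definition bstep_eqb (s t : bstep) : bool :=
  match s, t with Bu, Bu | Bb, Bb | Br, Br => true | _, _ => false end.

Lemma bstep_eqP : Equality.axiom bstep_eqb.
Proof. by do 2!case; constructor. Qed.

HB.instance Definition _ := hasDecEq.Build bstep bstep_eqP.

(* In a restricted bicolored Dyck path the last run of red steps is preceded by
   an up step, so j_l is the number of trailing red steps. *)
Definition lastB (B : seq bstep) : nat := find (predC1 Br) (rev B).

Definition dsumB (B1 B2 : seq bstep) : seq bstep :=
  take (size B1 - lastB B1) B1 ++ B2 ++ nseq (lastB B1) Br.

Definition wordB (s : step) : seq bstep :=
  Bu :: nseq `|1 - s.2|%N Br ++ nseq `|s.1|%N Bb.

(* On an F-path the subtraction is not truncated, and the last run brings the
   path back to the x-axis. *)
Definition psiB (Q : seq step) : seq bstep :=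
  let B := flatten (map wordB Q) ++ [:: Bu] in
  B ++ nseq (count_mem Bu B - count (predC1 Bu) B) Br.

Definition dsumS (p q : seq nat) : seq nat := p ++ [seq v + size p | v <- q].

(* p is the direct sum of a permutation of length i and of [dropS i p]. *)
Definition cutS (p : seq nat) (i : nat) : bool := perm_eq (take i p) (iota 1 i).

Definition dropS (i : nat) (p : seq nat) : seq nat :=
  [seq v - i | v <- drop i p].

Definition permS (p : seq nat) : bool := perm_eq p (iota 1 (size p)).

Definition indecomposable (p : seq nat) : Prop :=
  [/\ permS p, p <> [::] &
      forall q r, permS q -> permS r -> p = dsumS q r -> q = [::] \/ r = [::]].

(* Each indecomposable summand is counted by the place where it ends; see
   [block_dsum]. *)
Definition block (p : seq nat) : nat := count (cutS p) (iota 1 (size p)).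

Lemma iota1D m n : iota 1 (m + n) = iota 1 m ++ map (addn m) (iota 1 n).
Proof. by rewrite iotaD -iotaDl addnC. Qed.

Lemma cutS_dsumr q r i : permS q -> cutS (dsumS q r) (size q + i) = cutS r i.
Proof.
move=> pq; rewrite /cutS /dsumS iota1D take_cat ltnNge leq_addr /= addKn -map_take.
rewrite (permPl (perm_cat (pq : perm_eq q _) (perm_refl _))) perm_cat2l.
under eq_map => v do rewrite addnC.
by apply/idP/idP => [/(perm_map_inj (@addnI _))|/(perm_map (addn (size q)))].
Qed.

Lemma block_cat q r : permS q -> block (dsumS q r) = block q + block r.
Proof.
move=> pq; rewrite /block size_cat size_map iota1D count_cat count_map.
congr (_ + _); last by apply: eq_count => i; exact: cutS_dsumr.
apply: eq_in_count => i; rewrite mem_iota => /andP[_ ilt].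
rewrite /cutS /dsumS take_cat; case: ltnP => // qi.
have -> : i = size q by apply/eqP; rewrite eqn_leq qi -ltnS -[_.+1]add1n ilt.
by rewrite subnn take0 cats0 take_size.
Qed.

Lemma block_indecomposable p : indecomposable p -> block p = 1.
Proof.
case=> pp p0 indec; rewrite /block; case sp: (size p) => [|n].
  by case: p0; apply/size0nil.
rewrite -[n.+1]addn1 iotaD count_cat /= addn0 add1n -sp /cutS take_size.
rewrite [X in nat_of_bool X]pp addn1; congr _.+1; apply/eqP; rewrite -leqn0 leqNgt -has_count.
apply/hasP => -[i]; rewrite mem_iota add1n ltnS => /andP[i0 lei] ci.
have ltip : i < size p by rewrite sp ltnS.
have si : size (take i p) = i by rewrite size_takel // ltnW.
have pt : permS (take i p) by rewrite /permS si.
have pd : perm_eq (drop i p) (map (addn i) (iota 1 (size p - i))).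
  rewrite -(perm_cat2l (take i p)) cat_take_drop.
  rewrite (permPr (perm_cat ci (perm_refl _))) -iota1D subnKC //.
  exact: ltnW.
have ge v : v \in drop i p -> i <= v.
  by rewrite (perm_mem pd) => /mapP[u _ ->]; apply: leq_addr.
have pr : permS (dropS i p).
  rewrite /permS size_map size_drop.
  apply: perm_trans (perm_map (subn^~ i) pd) _; rewrite -map_comp.
  by rewrite (@eq_map _ _ _ id) ?map_id // => u /=; rewrite addKn.
have pE : p = dsumS (take i p) (dropS i p).
  rewrite /dsumS -map_comp si -{1}(cat_take_drop i p); congr (_ ++ _).
  by rewrite -[LHS]map_id; apply/eq_in_map => v /ge iv /=; rewrite subnK.
case: (indec _ _ pt pr pE) => /(congr1 size) /=.
  by rewrite si => i_0; rewrite i_0 in i0.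
by rewrite size_map size_drop => /eqP; rewrite subn_eq0 leqNgt ltip.
Qed.

Lemma block_dsum (ps : seq (seq nat)) :
  (forall p, p \in ps -> indecomposable p) ->
  block (foldr dsumS [::] ps) = size ps.
Proof.
elim: ps => //= p ps IH ind; have ip := ind p (mem_head _ _).
rewrite block_cat; last by case: ip.
by rewrite block_indecomposable // IH // => q qps; apply: ind; rewrite in_cons qps orbT.
Qed.

(* [ssplit m p] is |s| for the decomposition of p as the direct sum of s and t
   with block(t) = m. *)
Definition ssplit (m : nat) (p : seq nat) : nat :=
  find (fun i => cutS p i && (block (dropS i p) == m)) (iota 0 (size p).+1).

(* Here [p i] is the i-th entry, i >= 1, of the permutation psi(Q') of length n,
   and each branch returns the i-th entry of psi(Q's). *)
Definition stepS (w : seq nat) (s : step) : seq nat :=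
  let: (a, b) := s in
  let n := size w in
  let p i := nth 0 w i.-1 in
  let pos v := (index v w).+1 in
  let k := `|a - 2|%N in
  if a == 0%R then dsumS w [:: 1]
  else if a == 1%R then
    let j := `|1 - b|%N in
    let x := (ssplit j.+1 w).+1 in
    [seq if i < x then p i else if i == x then n.+1 else p i.-1
       | i <- iota 1 n.+1]
  else if b == 1%R then
    let x := (ssplit k.+1 w).+1 in
    let y := pos x.-1 in
    [seq if i == y then n
         else if i < x then p i
         else if i == x then n.+1
         else (p i.-1).-1
       | i <- iota 1 n.+1]
  else
    let j := `|b|%N in
    let z := ssplit j.+1 w in
    let x := (ssplit k.+1 (take z w)).+1 in
    let y := pos x.-1 in
    [seq if i == y then z
         else if i < x then p i
         else if i == x then n.+1
         else if i <= z.+1 then (p i.-1).-1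
         else p i.-1
       | i <- iota 1 n.+1].

Definition psiS (Q : seq step) : seq nat := foldl stepS [:: 1] Q.

Definition inversion_seq (n : nat) (e : seq nat) : Prop :=
  size e = n /\ forall i, i < n -> nth 0 e i < i.+1.

Definition classI (n : nat) : set (seq nat) :=
  [set e | inversion_seq n e /\
     forall i j k, i < j -> j < k -> k < n ->
       ~ (nth 0 e j < nth 0 e i /\ nth 0 e i = nth 0 e k \/
          nth 0 e j < nth 0 e i /\ nth 0 e i < nth 0 e k)].

Definition maxI (e : seq nat) : nat := \max_(v <- e) v.

Definition prmx (e : seq nat) : nat := size e - index (maxI e) (rev e).

Definition hatI (e : seq nat) : seq nat :=
  take (prmx e).-1 e ++ drop (prmx e) e.

Definition dsumI (e f : seq nat) : seq nat :=
  take (prmx e) e ++ [seq v + maxI e | v <- f] ++ drop (prmx e) e.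

Fixpoint phiI_rec (n : nat) (e : seq nat) : seq step :=
  if n is m.+1 then
    rcons (phiI_rec m (hatI e))
      ((maxI e)%:Z - (maxI (hatI e))%:Z, (prmx e)%:Z - (prmx (hatI e))%:Z)%R
  else [::].

Definition phiI (e : seq nat) : seq step := phiI_rec (size e).-1 e.

Definition psiI (Q : seq step) : seq nat :=
  'pinv_(fun=> [::]) (classI (size Q).+1) phiI Q.

Definition classJ (n : nat) : set (seq nat) :=
  [set e | inversion_seq n e /\
     forall i j k, i < j -> j < k -> k < n ->
       ~ (nth 0 e j < nth 0 e i /\ nth 0 e i = nth 0 e k \/
          nth 0 e i < nth 0 e k /\ nth 0 e k < nth 0 e j)].

(* The number of zeros at the beginning of e. *)
Definition firstJ (e : seq nat) : nat := find (predC1 0) e.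

(* The exponents j_v and i_v of v and of the 0 that follows it in the normal form
   0^i_0 1^j_1 0^i_1 ... n^j_n 0^i_n of e; see [phiJE]. *)
Definition expJ (e : seq nat) (v : nat) : nat := count_mem v e.

Definition exp0J (e : seq nat) (v : nat) : nat :=
  if v \in e then firstJ (drop (size e - index v (rev e)) e) else 0.

Definition dsumJ (e f : seq nat) : seq nat :=
  nseq (firstJ e) 0 ++ f ++
  [seq if 0 < v then v + size f else 0 | v <- drop (firstJ e) e].

Definition phiJ (e : seq nat) : seq step :=
  [seq ((expJ e v)%:Z, 1 - (exp0J e v)%:Z)%R | v <- rev (iota 1 (size e).-1)].

Fixpoint wordJ (v : nat) (l : seq (nat * nat)) : seq nat :=
  if l is (j, i) :: l' then nseq j v ++ nseq i 0 ++ wordJ v.+1 l' else [::].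

Lemma firstJ_wordJ v l : 0 < v ->
  all (fun x => (x.1 == 0) ==> (x.2 == 0)) l -> firstJ (wordJ v l) = 0.
Proof.
elim: l v => [|[[|j] i] l IH] [|v] //= _ /andP[/eqP i0 hl].
by rewrite i0; apply: IH.
Qed.

Lemma notin_wordJ u v l : 0 < u < v -> u \notin wordJ v l.
Proof.
elim: l v => [|[j i] l IH] v //= /andP[u0 uv].
rewrite !mem_cat !mem_nseq !negb_or !negb_and (ltn_eqF uv) (gtn_eqF u0) !orbT /=.
by apply: IH; rewrite u0 ltnW.
Qed.

Lemma expJ_wordJ (A : seq nat) v l : 0 < v -> all (ltn^~ v) A ->
  all (fun x => (x.1 == 0) ==> (x.2 == 0)) l ->
  [seq (expJ (A ++ wordJ v l) u, exp0J (A ++ wordJ v l) u)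
     | u <- iota v (size l)] = l.
Proof.
elim: l v A => [|[j i] l IH] v A v0 hA //= /andP[hji hl].
have vA : v \notin A by apply/negP => /(allP hA) /=; rewrite ltnn.
have vW : v \notin wordJ v.+1 l by apply: notin_wordJ; rewrite v0 ltnSn.
have vZ : v \notin nseq i 0 ++ wordJ v.+1 l.
  by rewrite mem_cat mem_nseq negb_or negb_and (gtn_eqF v0) orbT vW.
have := IH v.+1 (A ++ nseq j v ++ nseq i 0).
rewrite -!catA => -> //; last first.
  rewrite !all_cat !all_nseq /= ltnSn ltnS leq0n !orbT !andbT.
  by apply: sub_all hA => u /= /ltnW.
congr ((_, _) :: _).
  rewrite /expJ !count_cat !count_nseq /= eqxx mul1n (ltn_eqF v0) mul0n.
  by rewrite (count_memPn vA) (count_memPn vW) add0n !addn0.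
rewrite /exp0J !mem_cat (negPf vA) mem_nseq eqxx andbT -mem_cat (negPf vZ) orbF.
case: j hji => [/eqP -> //|j _] /=.
set Z := nseq i 0 ++ _.
have -> : A ++ v :: nseq j v ++ Z = (A ++ nseq j.+1 v) ++ Z by rewrite -catA.
rewrite rev_cat index_cat mem_rev (negPf vZ) -[j.+1]addn1 nseqD catA.
rewrite [X in index v X](_ : _ = v :: rev (A ++ nseq j v)); last by rewrite rev_cat.
rewrite /= eqxx addn0 size_rev size_cat addnK drop_size_cat //.
rewrite /firstJ find_cat has_nseq /= andbF size_nseq.
by rewrite [find _ _]firstJ_wordJ ?addn0.
Qed.

(* With l = (a_n, 1 - b_n), ..., (a_1, 1 - b_1), the equation that defines
   phi_J. *)
Lemma phiJE i0 (l : seq (nat * nat)) (e := nseq i0 0 ++ wordJ 1 l) :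
  all (fun x => (x.1 == 0) ==> (x.2 == 0)) l -> size e = (size l).+1 ->
  phiJ e = rev [seq ((x.1)%:Z, 1 - (x.2)%:Z)%R | x <- l].
Proof.
move=> hl se; rewrite /phiJ se map_rev; congr rev.
rewrite -[in RHS](@expJ_wordJ (nseq i0 0) 1 l) -?map_comp //.
by rewrite all_nseq orbT.
Qed.

Definition psiJ (Q : seq step) : seq nat :=
  'pinv_(fun=> [::]) (classJ (size Q).+1) phiJ Q.

(* A vertex other than the root, with its weight and the subtrees at its
   children from left to right. A leaf carries the dummy weight 0. *)
Inductive vertex := Vertex of nat & seq vertex.

HB.instance Definition _ := gen_eqMixin vertex.
HB.instance Definition _ := gen_choiceMixin vertex.

(* A tree is the sequence of the subtrees at the children of its (unweighted)
   root, from left to right. *)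
Definition wtree : Type := seq vertex.

Fixpoint weighted (v : vertex) : bool :=
  let: Vertex w c := v in
  (if c is [::] then w == 0 else 1 <= w <= size c) && all weighted c.

(* Each vertex other than the root is the lower end of exactly one edge. *)
Fixpoint vertices (v : vertex) : nat :=
  let: Vertex _ c := v in (sumn (map vertices c)).+1.

Definition edges (T : wtree) : nat := sumn (map vertices T).

Definition classT (n : nat) : set wtree :=
  [set T | all weighted T /\ edges T = n].

(* A tree is written (T_1,...,T_r) from right to left, so the summands of
   T (+) S appear in the order S, T from left to right. *)
Definition dsumT (T S : wtree) : wtree := rev (rev T ++ rev S).

(* The steps attached to the vertices of the subtree at v, in preorder, where s
   is the step attached to v itself. *)
Fixpoint preorder_steps (s : step) (v : vertex) : seq step :=
  let: Vertex w c := v in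
  s :: (if c is v1 :: c' then
          preorder_steps (w%:Z, w%:Z - (size c)%:Z + 1)%R v1 ++
          flatten (map (preorder_steps (0, 1)%R) c')
        else [::]).

(* The vertices v_1, v_2, ... other than the root v_0 are listed in preorder,
   v_1 is dropped and the order is reversed. *)
Definition phiT (T : wtree) : seq step :=
  rev (behead (flatten (map (preorder_steps (0, 1)%R) T))).

Definition psiT (Q : seq step) : wtree :=
  'pinv_(fun=> [::]) (classT (size Q).+1) phiT Q.

Variant fam := FamP | FamB | FamS | FamI | FamJ | FamT.

Definition obj (A : fam) : Type :=
  match A with
  | FamP => seq pstep
  | FamB => seq bstep
  | FamS | FamI | FamJ => seq nat
  | FamT => wtree
  end.

Definition dsum (A : fam) : obj A -> obj A -> obj A :=
  match A with
  | FamP => dsumP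
  | FamB => dsumB
  | FamS => dsumS
  | FamI => dsumI
  | FamJ => dsumJ
  | FamT => dsumT
  end.

Definition psi (A : fam) : seq step -> obj A :=
  match A with
  | FamP => psiP
  | FamB => psiB
  | FamS => psiS
  | FamI => psiI
  | FamJ => psiJ
  | FamT => psiT
  end.

(* Main.v *)
Require Import Defs.
From mathcomp Require Import all_boot all_order all_algebra.
From mathcomp Require Import classical_sets functions zify.
Set Implicit Arguments.
Unset Strict Implicit.
Unset Printing Implicit Defensive.

(** Everything rests on the case of two summands, proved for summands of
    arbitrary height: psi_A(Q (+) R) = psi_A(Q) (+) psi_A(R) for all F-paths Q
    and R ([psi_dsumF]). The iterated statement follows by induction along the
    left-to-right sum ([foldl_morph_in]), since the sum of two F-paths is an
    F-path ([Fpath_dsumF]).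

    For two summands the reason is the same in all families: R is an F-path
    in its own right, so the construction of the object of Q (+) R, once it has
    reached the object of Q, only ever acts on the summand grown from R.

    For P, S, I and T the map psi_A is the iteration of an operation [step] that
    appends one step s of the path, and [foldl_dsumF] reduces the claim to
    step (x (+) y) s = x (+) step y s, where x and y come from Q and R and s may
    follow R, that is, s.1 - s.2 <= ht R. A statistic of y equal to ht R up to a
    constant turns this inequality into the statement that the places of y
    modified by the step exist within y: hox for Schroeder paths
    ([psiP_hox]), the number of blocks for permutations ([psiS_block]), the
    number of subtrees at the root for trees ([size_treeT]), and max and prmx,
    which together record the endpoint of the path, for inversion sequences
    ([invseqI_spec]).

    - For Schroeder paths and permutations the step is described by a
      decomposition of the object, which [stepP_spec] and [stepS_spec] turn into
      relations. The decomposition is unique ([hsplit_hox], [ssplit_block]),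
      hence a decomposition of y extends to one of x (+) y. The three
      rules for permutations with s.1 >= 1 are a single operation [raiseS].
    - For the (101,102)-avoiding sequences and the trees, psi is given as the
      inverse of phi. Undoing one recursive call of phi gives the operations
      [stepI] (insert a new rightmost maximum) and [stepT] (attach a vertex above
      the leftmost subtrees, or a new leaf); their iteration is shown to be a
      two-sided inverse of phi, and therefore equals psi ([pinv_cancel]).

    For B and J there is a closed formula for psi, in which the direct sum
    is visible as a concatenation: the word attached to Q (+) R
    is the concatenation of those attached to Q and R (in the opposite order for
    J, with the letters coming from Q shifted), up to a run of letters whose
    length is additive because ht (Q (+) R) + 1 = (ht Q + 1) + (ht R + 1). For J
    the formula has to be shown inverse to phi, which is the existence of the
    normal form 0^i_0 1^j_1 0^i_1 ... ([classJ_normal]). *)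

(** * Iterated sums, inverses and searches *)

Lemma foldl_morph_in (X Y : Type) (D : X -> Prop) (f : X -> Y) opX opY :
  (forall x y, D x -> D y -> D (opX x y)) ->
  (forall x y, D x -> D y -> f (opX x y) = opY (f x) (f y)) ->
  forall k (xs : k.+1.-tuple X), (forall i, D (tnth xs i)) ->
  f (dsums opX xs) = dsums opY [tuple of map f xs].
Proof.
move=> opD fM k xs Dxs; rewrite /dsums.
have [x [s E]] : exists x s, xs = x :: s :> seq X.
  by case: (tval xs) (size_tuple xs) => // x s _; exists x, s.
have Dx0 i : i < size (x :: s) -> D (nth x (x :: s) i).
  rewrite -E size_tuple => ltik.
  by rewrite -(tnth_nth x xs (Ordinal ltik)).
have -> : thead xs = x by rewrite /thead (tnth_nth x) E.
have -> : thead [tuple of map f xs] = f x by rewrite /thead (tnth_nth (f x)) /= E.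
rewrite /= E /=.
(* Only the accumulator of the fold is generalized, not the default of [nth]. *)
have: forall i, i < size s -> D (nth x s i) by move=> i; apply: (Dx0 i.+1).
move: (Dx0 0 isT) => /=; clear Dx0 E; move: {1 3 4}x => y.
elim: s y => //= z s IH y Dy Ds.
rewrite IH ?fM //.
- exact: (Ds 0).
- by apply: opD => //; apply: (Ds 0).
- by move=> i; apply: (Ds i.+1).
Qed.

(** A left inverse of f on A makes f injective on A, and so agrees there with
    the chosen inverse of f; this is how explicit formulas for psi are obtained. *)
Lemma pinv_cancel (X Y : Type) (dflt : Y -> X) (A : set X) (f : X -> Y) (g : Y -> X) x :
  (forall x, A x -> g (f x) = x) -> A x -> 'pinv_dflt A f (f x) = x.
Proof.
move=> gf Ax; apply: pinvKV; last by rewrite inE.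
by move=> u v; rewrite !inE => Au Av fuv; rewrite -(gf u) // fuv gf.
Qed.

(** [psiP] and [psiS] search for their decompositions from the left; uniqueness of
    the decomposition then identifies the result of the search. *)
Lemma find_iota (p : pred nat) n i : i < n -> p i -> (forall j, j < i -> ~~ p j) ->
  find p (iota 0 n) = i.
Proof.
move=> ltin pi pj; rewrite -(subnKC (ltnW ltin)) iotaD find_cat.
have -> : has p (iota 0 i) = false.
  by apply/negbTE/hasPn => j; rewrite mem_iota => /pj.
by rewrite size_iota -(subnSK ltin) /= add0n pi addn0.
Qed.

(** * F-paths *)

Lemma endpoint_nil : endpoint [::] = (0, 0)%R.
Proof. by rewrite /endpoint big_nil. Qed.

Lemma endpoint_cat Q R : endpoint (Q ++ R) = (endpoint Q + endpoint R)%R.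
Proof. by rewrite /endpoint big_cat. Qed.

Lemma endpoint_rcons Q s : endpoint (rcons Q s) = (endpoint Q + s)%R.
Proof. by rewrite -cats1 endpoint_cat /endpoint big_seq1. Qed.

Lemma ht_rcons Q s : ht (rcons Q s) = (ht Q + s.2 - s.1)%R.
Proof. rewrite /ht endpoint_rcons /=; lia. Qed.

(** Prefixes of F-paths are F-paths; this is what allows all the inductions to
    remove the last step. *)
Lemma Fpath_rcons Q s :
  Fpath (rcons Q s) = [&& Fpath Q, inF s & (0 <= ht (rcons Q s))%R].
Proof.
rewrite /Fpath size_rcons -[(size Q).+1]addn1 iotaD all_cat all_rcons /= add1n.
rewrite take_oversize ?size_rcons // andbT /ht.
rewrite (@eq_in_all _ _ (fun i => (endpoint (take i Q)).1 <= (endpoint (take i Q)).2)%R).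
  have -> (x y : int) : (0 <= x - y)%R = (y <= x)%R by lia.
  by case: (inF s); case: (all _ _); case: (all _ _); case: (_ <= _)%R.
by move=> i; rewrite mem_iota => hi; rewrite -cats1 takel_cat //; lia.
Qed.

(** The hypothesis s.1 - s.2 <= ht Q says that the height after s is nonnegative. *)
Lemma Fpath_ind (P : seq step -> Prop) : P [::] ->
  (forall Q s, Fpath Q -> inF s -> (s.1 - s.2 <= ht Q)%R -> P Q -> P (rcons Q s)) ->
  forall Q, Fpath Q -> P Q.
Proof.
move=> P0 PS; elim/last_ind => // Q s IH; rewrite Fpath_rcons => /and3P[FQ Fs].
by rewrite ht_rcons => h; apply: PS => //; [lia | exact: IH].
Qed.

Lemma ht_ge0 Q : Fpath Q -> (0 <= ht Q)%R.
Proof.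
elim/last_ind: Q => [|Q s _]; first by rewrite /ht endpoint_nil.
by rewrite Fpath_rcons => /and3P[].
Qed.

Lemma inFP s : inF s -> s = (0, 1)%R \/ (1 <= s.1)%R /\ (s.2 <= 1)%R.
Proof. by case/orP => [/andP[? ?]|/eqP]; [right | left]. Qed.

Lemma ht_dsumF Q R : ht (dsumF Q R) = (ht Q + ht R + 1)%R.
Proof.
rewrite /ht /dsumF endpoint_cat -cat1s endpoint_cat /endpoint big_seq1 /=; lia.
Qed.

Lemma dsumF_rcons Q R s : dsumF Q (rcons R s) = rcons (dsumF Q R) s.
Proof. by rewrite /dsumF rcons_cat rcons_cons. Qed.

Lemma dsumF_nil Q : dsumF Q [::] = rcons Q (0, 1)%R.
Proof. by rewrite /dsumF cats1. Qed.

Lemma Fpath_dsumF Q R : Fpath Q -> Fpath R -> Fpath (dsumF Q R).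
Proof.
move=> FQ FR; have hQ := ht_ge0 FQ; move: R FR; apply: Fpath_ind => [|R s FR Fs h IH].
  by rewrite dsumF_nil Fpath_rcons FQ ht_rcons /inF /=; lia.
rewrite dsumF_rcons Fpath_rcons IH Fs ht_rcons ht_dsumF /=; lia.
Qed.

Lemma Fpath_take m Q : Fpath Q -> Fpath (take m Q).
Proof.
move=> FQ; elim/last_ind: Q FQ => [//|Q s IH]; rewrite -cats1 => FQ.
rewrite take_cat; case: ltnP => h.
  by apply: IH; move: FQ; rewrite cats1 Fpath_rcons => /andP[].
case: (m - size Q) => [|k] /=; last by [].
by move: FQ; rewrite cats0 cats1 Fpath_rcons => /andP[].
Qed.

(** The step (0,1) that joins Q and R starts a new trivial summand, and the steps
    of R then act on that summand only. *)
Lemma foldl_dsumF (X : Type) (st : X -> step -> X) (x0 : X) (op : X -> X -> X)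
    (g := foldl st x0) :
  (forall Q, Fpath Q -> st (g Q) (0, 1)%R = op (g Q) x0) ->
  (forall Q R s, Fpath Q -> Fpath R -> inF s -> (s.1 - s.2 <= ht R)%R ->
     st (op (g Q) (g R)) s = op (g Q) (st (g R) s)) ->
  forall Q R, Fpath Q -> Fpath R -> g (dsumF Q R) = op (g Q) (g R).
Proof.
move=> g0 gS Q R FQ FR; move: R FR; apply: Fpath_ind => [|R s FR Fs h IH].
  by rewrite dsumF_nil /g foldl_rcons g0.
by rewrite dsumF_rcons {1 3}/g !foldl_rcons -/(g _) IH gS.
Qed.

(** * Restricted bicolored Dyck paths *)

(** Each step changes the number of u minus the number of down steps by s.2 - s.1,
    so the final u leaves the path at height ht Q + 1. *)
Lemma psiB_tail Q : Fpath Q ->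
  psiB Q = flatten (map wordB Q) ++ Bu :: nseq `|(ht Q + 1)%R|%N Br.
Proof.
move=> FQ; have h0 := ht_ge0 FQ.
rewrite /psiB -catA /=; congr (_ ++ _ :: nseq _ _).
rewrite !count_cat /=.
suff : ((count_mem Bu (flatten (map wordB Q)))%:Z =
        (count (predC1 Bu) (flatten (map wordB Q)))%:Z + ht Q)%R.
  rewrite -![count (pred1 Bu) _]/(count_mem Bu _); set c := count_mem Bu _; set d := count _ _.
  lia.
clear h0; move: Q FQ; apply: Fpath_ind => [|Q [a b] FQ Fs h IH].
  by rewrite /ht endpoint_nil.
rewrite ht_rcons map_rcons flatten_rcons !count_cat /wordB /= !count_cat !count_nseq /=.
move: h IH; set c := count_mem Bu _; set d := count _ _.
by case: (inFP Fs) => /= [[-> ->]|[a1 b1]]; lia.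
Qed.

Lemma lastB_tail B t : lastB (B ++ Bu :: nseq t Br) = t.
Proof.
rewrite /lastB rev_cat rev_cons rev_nseq -cats1 -!catA find_cat has_nseq.
by rewrite /= andbF size_nseq addn0.
Qed.

Lemma dsumB_tail B1 t B2 :
  dsumB (B1 ++ Bu :: nseq t Br) B2 = B1 ++ Bu :: B2 ++ nseq t Br.
Proof.
rewrite /dsumB lastB_tail -(cat1s Bu (nseq _ _)) (catA B1) size_cat size_nseq addnK.
by rewrite take_size_cat // -catA.
Qed.

Lemma psiB_dsumF Q R : Fpath Q -> Fpath R ->
  psiB (dsumF Q R) = dsumB (psiB Q) (psiB R).
Proof.
move=> FQ FR; rewrite !psiB_tail ?Fpath_dsumF // dsumB_tail ht_dsumF.
have [hQ hR] := (ht_ge0 FQ, ht_ge0 FR).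
rewrite /dsumF map_cat flatten_cat /= -!catA /= -nseqD.
by do 2!congr (_ ++ _ :: _); congr nseq; lia.
Qed.

(** * Weighted ordered trees *)

(** The state is the list of the subtrees, from left to right, built from the
    vertices read so far in reverse preorder. A step (0,1) means that the vertex
    read last is not the leftmost child of an interior vertex, so the next one is
    a leaf; a step (a,b) means that the next vertex is its parent, of weight a and
    with a - b + 1 children, the leftmost subtrees of the list. *)
Definition stepT (T : wtree) (s : step) : wtree :=
  if s.1 == 0%R then Vertex 0 [::] :: T
  else let d := `|(s.1 - s.2 + 1)%R|%N in Vertex `|s.1|%N (take d T) :: drop d T.

Definition treeT (Q : seq step) : wtree := foldl stepT [:: Vertex 0 [::]] Q.

Lemma size_stepT T s : inF s -> (s.1 - s.2 < (size T)%:Z)%R ->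
  ((size (stepT T s))%:Z = (size T)%:Z + s.2 - s.1)%R.
Proof.
case: s => a b Fs /= h; rewrite /stepT /=.
case: (inFP Fs) => /= [[-> ->] //=|[a1 b1]]; first by lia.
by rewrite ifF /= ?size_drop; lia.
Qed.

(** Merging a - b + 1 subtrees into one changes their number by b - a. *)
Lemma size_treeT Q : Fpath Q -> ((size (treeT Q))%:Z = ht Q + 1)%R.
Proof.
move: Q; apply: Fpath_ind => [|Q s FQ Fs h IH]; first by rewrite /ht endpoint_nil.
by rewrite ht_rcons /treeT foldl_rcons size_stepT -/(treeT Q) ?IH //; lia.
Qed.

(** Only the leftmost subtrees are touched, and the sum of trees places its second
    summand on the left. *)
Lemma stepT_cat T U s : inF s -> (s.1 - s.2 < (size T)%:Z)%R ->
  stepT (T ++ U) s = stepT T s ++ U.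
Proof.
case: s => a b Fs /= h; rewrite /stepT /=; case: eqP => // a0.
case: (inFP Fs) => /= [[/a0] //|[a1 b1]].
have dT : `|(a - b + 1)%R|%N <= size T by lia.
rewrite takel_cat // drop_cat; case: ltnP => // Td.
have -> : `|(a - b + 1)%R|%N = size T by lia.
by rewrite subnn drop0 drop_size.
Qed.

Lemma treeT_dsumF Q R : Fpath Q -> Fpath R ->
  treeT (dsumF Q R) = dsumT (treeT Q) (treeT R).
Proof.
have dE T U : dsumT T U = U ++ T by rewrite /dsumT rev_cat !revK.
apply: (@foldl_dsumF _ stepT [:: Vertex 0 [::]]) => [{}Q FQ|{}Q {}R s FQ FR Fs h].
  by rewrite dE /stepT /=.
by rewrite !dE stepT_cat // -/(treeT R) size_treeT //; lia.
Qed.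

Lemma edges_cat T U : edges (T ++ U) = edges T + edges U.
Proof. by rewrite /edges map_cat sumn_cat. Qed.

Lemma classT_stepT n T s : inF s -> (s.1 - s.2 < (size T)%:Z)%R ->
  classT n T -> classT n.+1 (stepT T s).
Proof.
case: s => a b Fs /= h [wT eT]; rewrite /stepT /classT /=; case: eqP => [_|a0] /=.
  by rewrite wT /edges /= -/(edges T) eT.
case: (inFP Fs) => /= [[/a0] //|[a1 b1]].
set d := absz _; have dT : d <= size T by lia.
move: wT eT; rewrite -{1 2}(cat_take_drop d T) all_cat edges_cat => /andP[-> ->] <-.
rewrite /edges /=; split=> //.
have := size_takel dT; case: (take d T) => [|v c] sE; move: sE => /=; lia.
Qed.

Lemma classT_treeT Q : Fpath Q -> classT (size Q).+1 (treeT Q).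
Proof.
move: Q; apply: Fpath_ind => [//|Q s FQ Fs h IH].
rewrite size_rcons /treeT foldl_rcons; apply: classT_stepT => //.
by rewrite -/(treeT Q) size_treeT //; lia.
Qed.

Lemma preorder_steps_head s v :
  preorder_steps s v = s :: behead (preorder_steps (0, 1)%R v).
Proof. by case: v. Qed.

(** The new vertex comes first in preorder, where its own step is the one dropped
    by [phiT]; the step s appears in front of the steps previously kept, because it
    is attached to the vertex that used to be first. *)
Lemma phiT_stepT T s : inF s -> (s.1 - s.2 < (size T)%:Z)%R -> T != [::] ->
  phiT (stepT T s) = rcons (phiT T) s.
Proof.
case: s T => a b [|v T] //= Fs /= h _; rewrite /phiT -rev_cons; congr rev.
rewrite /stepT /=; case: eqP => [a0|a0] /=.
  have -> : (a, b) = (0, 1)%R by case: (inFP Fs) => /= [|[]] //; lia.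
  by rewrite preorder_steps_head.
case: (inFP Fs) => /= [[/a0] //|[a1 b1]].
have [d dE] : exists d, `|(a - b + 1)%R|%N = d.+1 by exists `|(a - b)%R|%N; lia.
rewrite dE /= preorder_steps_head size_takel; last by lia.
rewrite [preorder_steps (0, 1)%R v]preorder_steps_head /= -catA -flatten_cat -map_cat.
rewrite cat_take_drop; congr ((_, _) :: _); lia.
Qed.

Lemma treeT_neq0 Q : treeT Q != [::].
Proof.
case/lastP: Q => [//|Q s]; rewrite /treeT foldl_rcons /stepT.
by case: ifP.
Qed.

Lemma phiT_treeT Q : Fpath Q -> phiT (treeT Q) = Q.
Proof.
move: Q; apply: Fpath_ind => [//|Q s FQ Fs h IH].
rewrite /treeT foldl_rcons phiT_stepT ?treeT_neq0 // -/(treeT Q) ?IH //.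
by rewrite size_treeT //; lia.
Qed.

(** The leftmost child of the root is either a leaf or an interior vertex, and
    removing it is the inverse of the first or second case of [stepT]. *)
Lemma classT_inv n T : classT n.+2 T -> exists U s,
  [/\ classT n.+1 U, inF s, (s.1 - s.2 < (size U)%:Z)%R & T = stepT U s].
Proof.
case=> + eT; case: T eT => [|[w c] T] //= [eT] /andP[/andP[hw wc] wT].
case: c wc hw eT => [_ /eqP -> eT|v c wc /andP[w1 wle] eT].
  exists T, (0, 1)%R; split=> //; case: T eT {wT} => // v T _ /=; lia.
exists ((v :: c) ++ T), (w%:Z, w%:Z - (size c)%:Z)%R; split.
- split; first by rewrite all_cat wc.
  by rewrite edges_cat -eT.
- by rewrite /inF /=; move: wle => /=; lia.
- by rewrite size_cat /=; lia.
rewrite /stepT ifF /=; last by lia.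
have -> : `|(w%:Z - (w%:Z - (size c)%:Z) + 1)%R|%N = (size c).+1 by lia.
by rewrite /= take_size_cat ?drop_size_cat //; congr (Vertex _ _ :: _); lia.
Qed.

Lemma edges_eq0 T : edges T = 0 -> T = [::].
Proof. by case: T => // [[]]. Qed.

Lemma treeT_phiT n T : classT n.+1 T -> treeT (phiT T) = T.
Proof.
elim: n T => [|n IH] T.
  case=> + eT; case: T eT => [|[w [|v c]] T] //= [].
    by move=> /edges_eq0 -> /andP[/andP[/eqP ->]].
  by case: v.
case/classT_inv => U [s [cU Fs h ->]].
have U0 : U != [::] by case: U cU {h} => // -[].
by rewrite phiT_stepT // /treeT foldl_rcons -/(treeT _) IH.
Qed.

Lemma psiT_treeT Q : Fpath Q -> psiT Q = treeT Q.
Proof.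
move=> FQ; rewrite -{2}(phiT_treeT FQ) /psiT.
rewrite -[X in 'pinv_ _ _ _ X](phiT_treeT FQ).
rewrite (pinv_cancel _ (@treeT_phiT (size Q))) //; last exact: classT_treeT.
by rewrite phiT_treeT.
Qed.

Lemma psiT_dsumF Q R : Fpath Q -> Fpath R ->
  psiT (dsumF Q R) = dsumT (psiT Q) (psiT R).
Proof.
move=> FQ FR; rewrite !psiT_treeT ?Fpath_dsumF //; exact: treeT_dsumF.
Qed.

(** * Inversion sequences avoiding 101 and 021 *)

(** The exponents (a_n, 1 - b_n), ..., (a_1, 1 - b_1) of the normal form, in the
    order in which the letters 1, 2, ..., n occur. *)
Definition pairsJ (Q : seq step) : seq (nat * nat) :=
  rev [seq (`|s.1|%N, `|(1 - s.2)%R|%N) | s <- Q].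

(** The number of leading zeros is forced by the length n + 1, since each
    step of the path contributes s.1 + 1 - s.2 letters. *)
Definition invseqJ (Q : seq step) : seq nat :=
  nseq `|(ht Q + 1)%R|%N 0 ++ wordJ 1 (pairsJ Q).

Lemma wordJ_cat v l1 l2 :
  wordJ v (l1 ++ l2) = wordJ v l1 ++ wordJ (v + size l1) l2.
Proof.
elim: l1 v => [|[j i] l1 IH] v /=; first by rewrite addn0.
by rewrite IH addSnnS !catA.
Qed.

Lemma wordJ_shift m v l : 0 < v ->
  wordJ (v + m) l = [seq if 0 < u then u + m else 0 | u <- wordJ v l].
Proof.
elim: l v => [|[j i] l IH] v v0 //=.
by rewrite -addSn IH // !map_cat !map_nseq v0.
Qed.

Lemma size_wordJ u v l : size (wordJ u l) = size (wordJ v l).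
Proof.
by elim: l u v => [|[j i] l IH] u v //=; rewrite !size_cat !size_nseq (IH _ v.+1).
Qed.

Lemma pairsJ_rcons Q s :
  pairsJ (rcons Q s) = (`|s.1|%N, `|(1 - s.2)%R|%N) :: pairsJ Q.
Proof. by rewrite /pairsJ map_rcons rev_rcons. Qed.

Lemma size_pairsJ Q : size (pairsJ Q) = size Q.
Proof. by rewrite size_rev size_map. Qed.

Lemma size_wordJ_pairsJ v Q : all (fun s : step => (0 <= s.1) && (s.2 <= 1))%R Q ->
  ((size (wordJ v (pairsJ Q)))%:Z = (size Q)%:Z - ht Q)%R.
Proof.
elim/last_ind: Q => [|Q [a b] IH]; first by rewrite /ht endpoint_nil.
rewrite all_rcons /= => /andP[ab /IH {}IH].
rewrite pairsJ_rcons ht_rcons /= !size_cat !size_nseq size_rcons (size_wordJ _ v).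
by lia.
Qed.

Lemma Fpath_steps Q : Fpath Q -> all (fun s : step => (0 <= s.1) && (s.2 <= 1))%R Q.
Proof.
case/andP=> FQ _; apply: sub_all FQ => s /inFP[->//|[]]; lia.
Qed.

Lemma pairsJ_imp Q : all inF Q ->
  all (fun x => (x.1 == 0) ==> (x.2 == 0)) (pairsJ Q).
Proof.
rewrite /pairsJ all_rev all_map; apply: sub_all => s /inFP[-> //|[]] /=; lia.
Qed.

Lemma size_invseqJ Q : Fpath Q -> size (invseqJ Q) = (size Q).+1.
Proof.
move=> FQ; have := ht_ge0 FQ; have := size_wordJ_pairsJ 1 (Fpath_steps FQ).
rewrite /invseqJ size_cat size_nseq; lia.
Qed.

Lemma phiJ_invseqJ Q : Fpath Q -> phiJ (invseqJ Q) = Q.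
Proof.
move=> FQ; rewrite phiJE; last first.
- by rewrite size_invseqJ // size_pairsJ.
- by apply: pairsJ_imp; case/andP: FQ.
rewrite /pairsJ map_rev revK -map_comp -[RHS]map_id; apply/eq_in_map => -[a b].
by move/(allP (Fpath_steps FQ)) => /= /andP[a0 b1]; congr (_, _); lia.
Qed.

Lemma firstJ_invseqJ Q : Fpath Q -> firstJ (invseqJ Q) = `|(ht Q + 1)%R|%N.
Proof.
case/andP=> FQ _; rewrite /invseqJ /firstJ find_cat has_nseq /= andbF size_nseq.
by rewrite [find _ _]firstJ_wordJ ?addn0 // pairsJ_imp.
Qed.

(** Since exponents are listed in reverse order, the word of R precedes the word of
    Q, whose letters are shifted by the length of R plus 1; the separating step
    (0,1) contributes the letter |R| + 1 with exponent 0. *)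
Lemma invseqJ_dsumF Q R : Fpath Q -> Fpath R ->
  invseqJ (dsumF Q R) = dsumJ (invseqJ Q) (invseqJ R).
Proof.
move=> FQ FR; have [hQ hR] := (ht_ge0 FQ, ht_ge0 FR).
rewrite /dsumJ firstJ_invseqJ // size_invseqJ // /invseqJ.
rewrite drop_size_cat ?size_nseq // -wordJ_shift // add1n catA [in RHS]catA.
rewrite -nseqD -catA; congr (nseq _ _ ++ _); first by rewrite ht_dsumF; lia.
rewrite /dsumF /pairsJ map_cat rev_cat /= rev_cons cat_rcons wordJ_cat.
by rewrite size_rev size_map /= add1n.
Qed.

(** Avoidance of 101 and 021 in an inversion sequence: as it starts with 0, it avoids
    021 only if its positive entries are weakly increasing. In this form the
    condition passes to suffixes, which need not start with 0. *)
Definition goodJ (w : seq nat) : Prop :=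
  (forall i k, i < k < size w -> 0 < nth 0 w k -> nth 0 w i <= nth 0 w k) /\
  (forall i j k, i < j -> j < k < size w -> nth 0 w i = nth 0 w k ->
     nth 0 w i <= nth 0 w j).

Lemma goodJ_drop m w : goodJ w -> goodJ (drop m w).
Proof.
case=> h1 h2; split=> [i k|i j k]; rewrite size_drop ?nth_drop.
  by move=> ik; apply: h1; lia.
by move=> ij jk; apply: h2; lia.
Qed.

Lemma goodJ_zeros m w : goodJ w -> goodJ (nseq m 0 ++ w).
Proof.
case=> h1 h2; split=> [i k|i j k]; rewrite size_cat size_nseq !nth_cat size_nseq !nth_nseq !if_same.
  by move=> ik; case: (ltnP k m) => // km; case: (ltnP i m) => // im; apply: h1; lia.
move=> ij jk; case: (ltnP i m) => // im; rewrite !ifF; try lia.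
by apply: h2; lia.
Qed.

Lemma goodJ_run j v w : (forall i, i < size w -> 0 < nth 0 w i -> v < nth 0 w i) ->
  goodJ w -> goodJ (nseq j v ++ w).
Proof.
move=> hv [h1 h2]; split=> [i k|i m k]; rewrite size_cat size_nseq !nth_cat size_nseq !nth_nseq.
  move=> ik; case: (ltnP k j) => kj; case: (ltnP i j) => ij //; try lia.
    by move=> h; apply/ltnW/hv => //; lia.
  by apply: h1; lia.
move=> im mk; case: (ltnP i j) => ij; last first.
  have [-> ->] : (k < j) = false /\ (m < j) = false by lia.
  by apply: h2; lia.
case: (ltnP k j) => kj; first by have -> : (m < j) = true by lia.
move=> E; case: (posnP v) => [-> //|v0].
by have := hv (k - j); rewrite -E; lia.
Qed.

Lemma wordJ_ge v l i : i < size (wordJ v l) -> 0 < nth 0 (wordJ v l) i ->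
  v <= nth 0 (wordJ v l) i.
Proof.
elim: l v i => [|[j m] l IH] v i //=.
rewrite !size_cat !nth_cat !size_nseq !nth_nseq if_same.
move=> iw; case: (ltnP i j) => // ij; case: (ltnP (i - j) m) => // im p.
by apply/ltnW/IH => //; lia.
Qed.

Lemma goodJ_wordJ v l : goodJ (wordJ v l).
Proof.
elim: l v => [|[j m] l IH] v /=; first by split=> [i k|i j k] /=; rewrite ?ltn0 ?andbF.
apply: goodJ_run; last exact: goodJ_zeros.
move=> i; rewrite size_cat nth_cat size_nseq nth_nseq if_same.
by move=> iw; case: (ltnP i m) => // im p; apply: wordJ_ge => //; lia.
Qed.

(** The entries equal to u are preceded by all entries except those of the letters
    u, u + 1, ... and the zeros following them, which by the last hypothesis take no
    more places than there are such letters; as the length is fixed, at least u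
    entries are left before them. The prefix Z absorbs the letters already
    treated by the induction. *)
Lemma leq_nth_wordJ (Z : seq nat) v l :
  (forall i, nth 0 Z i <= i) ->
  size Z + size (wordJ v l) = v + size l ->
  (forall m, m < size l -> size (wordJ v (drop m l)) <= size (drop m l)) ->
  forall i, nth 0 (Z ++ wordJ v l) i <= i.
Proof.
elim: l v Z => [|[j k] l IH] v Z hZ sZ hl i; first by rewrite cats0.
move: sZ; have /= := hl 0 isT; rewrite !size_cat !size_nseq => h0 sZ.
rewrite !catA; apply: IH => [{}i||m ml].
- rewrite !nth_cat !size_cat !size_nseq !nth_nseq !if_same.
  case: (ltnP i (size Z + j)) => // ij; case: (ltnP i (size Z)) => // Zi.
  by case: ifP => _; lia.
- by rewrite !size_cat !size_nseq /=; lia.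
- by rewrite (size_wordJ _ v); apply: (hl m.+1).
Qed.

(** The inversion condition holds because each prefix of Q ends weakly above the
    diagonal: the last m pairs of exponents come from the first m steps of Q. *)
Lemma classJ_invseqJ Q : Fpath Q -> classJ (size Q).+1 (invseqJ Q).
Proof.
move=> FQ; have [h1 h2] : goodJ (invseqJ Q) by apply/goodJ_zeros/goodJ_wordJ.
rewrite -size_invseqJ //; split; last first.
  move=> i j k ij jk ks [[hji /esym E]|[hik hkj]].
    by have := h2 i j k; lia.
  by have := h1 j k; lia.
split=> // i _; rewrite ltnS; apply: leq_nth_wordJ => [{}i||m].
- by rewrite nth_nseq if_same.
- by rewrite -size_cat size_pairsJ -[LHS]/(size (invseqJ Q)) size_invseqJ.
rewrite size_pairsJ => mQ.
have -> : drop m (pairsJ Q) = pairsJ (take (size Q - m) Q).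
  by rewrite /pairsJ drop_rev size_map map_take.
have FQm := Fpath_take (size Q - m) FQ.
have := size_wordJ_pairsJ 1 (Fpath_steps FQm); have := ht_ge0 FQm.
rewrite size_pairsJ; lia.
Qed.

Lemma cat_nseq_find (v : nat) w (j := find (predC1 v) w) : w = nseq j v ++ drop j w.
Proof.
rewrite {}/j; elim: w => //= u w IH; case: eqP => [->|_] //=.
by rewrite -IH.
Qed.

(** The normal form is read greedily: remove the maximal run of v, then the maximal
    run of 0. What is left contains no further v, as such a v would form a
    pattern 101 with the removed runs or break monotonicity. *)
Lemma wordJ_exists n v w : 0 < v -> goodJ w ->
  (forall i, i < size w -> nth 0 w i = 0 \/ v <= nth 0 w i < v + n) ->
  0 < head 1 w ->
  exists l, [/\ size l = n, all (fun x => (x.1 == 0) ==> (x.2 == 0)) l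
    & w = wordJ v l].
Proof.
elim: n v w => [|n IH] v w v0 [h1 h2] hw w0.
  exists [::]; split=> //; case: w h1 h2 hw w0 => // u w _ _ hw /=.
  by have := hw 0 isT; rewrite /=; lia.
pose j := find (predC1 v) w; pose w1 := drop j w; pose i := firstJ w1.
have wE : w = nseq j v ++ w1 by apply: cat_nseq_find.
have w1E : w1 = nseq i 0 ++ drop i w1 by apply: cat_nseq_find.
have w1n : w1 != [::] -> head 0 w1 != v.
  rewrite -size_eq0 size_drop subn_eq0 -ltnNge -has_find => /(nth_find 0).
  by rewrite /= -/j -nth0 nth_drop addn0.
have w2n : 0 < head 1 (drop i w1).
  case: (boolP (has (predC1 0) w1)) => [h|].
    by have := nth_find 1 h; rewrite /= -/(firstJ _) -/i -nth0 nth_drop addn0; lia.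
  by rewrite has_find -leqNgt -/(firstJ _) -/i => h; rewrite drop_oversize.
have ji : (j == 0) ==> (i == 0).
  apply/implyP=> /eqP j0; rewrite /i /w1 j0 drop0.
  by case: (w) w0 => //= u ? u0; rewrite /firstJ /=; case: u u0.
have dE k : nth 0 (drop i w1) k = nth 0 w (j + (i + k)) by rewrite !nth_drop.
have sE : size (drop i w1) = size w - (j + i) by rewrite !size_drop subnDA.
have w1k k : nth 0 w1 k = nth 0 w (j + k) by rewrite nth_drop.
have gw : goodJ (drop i w1) by do 2!apply: goodJ_drop.
clearbody i w1 j.
have := IH v.+1 (drop i w1) isT; case.
- exact: gw.
- move=> k; rewrite sE dE => ks; have kw : j + (i + k) < size w by lia.
  have [->|hk] := hw _ kw; [by left | right].
  suff : nth 0 w (j + (i + k)) != v by lia.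
  apply/eqP => kv; case: (posnP i) => i0.
    have w1nn : w1 != [::] by case: (w1) sE => //=; lia.
    have := w1n w1nn; have := w2n; rewrite i0 drop0.
    have -> : head 1 w1 = head 0 w1 by case: (w1) w1nn.
    rewrite -nth0 w1k addn0 => wj wjv.
    have jw : j < size w by lia.
    have wjlt : v < nth 0 w j by have := hw _ jw; lia.
    case: (posnP k) => k0; first by move: kv; rewrite i0 k0 !addn0; lia.
    by have := h1 j (j + (i + k)); lia.
  have j0 : 0 < j by move: ji; lia.
  have wj : nth 0 w j = 0.
    rewrite wE nth_cat size_nseq ltnn subnn w1E nth_cat size_nseq i0.
    by rewrite nth_nseq i0.
  have w00 : nth 0 w 0 = v by rewrite wE nth_cat size_nseq j0 nth_nseq j0.
  by have := h2 0 j (j + (i + k)); lia.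
- exact: w2n.
move=> l [sl hl lE]; exists ((j, i) :: l); split => /=; first by rewrite sl.
  by rewrite ji.
by rewrite -lE -w1E.
Qed.

Lemma classJ_normal n e : classJ n.+1 e -> exists l,
  [/\ size l = n, all (fun x => (x.1 == 0) ==> (x.2 == 0)) l
    & e = nseq (firstJ e) 0 ++ wordJ 1 l].
Proof.
case=> -[se hi] he.
have gd : goodJ e.
  split=> [i k|i j k]; rewrite se.
    move=> /andP[ik kn] k0; rewrite leqNgt; apply/negP => hki.
    have := hi 0 isT; have := he 0 i k => h e0.
    have i0 : 0 < i by case: (posnP i) hki => // ->; lia.
    by apply: h => //; lia.
  move=> ij /andP[jk kn] E; rewrite leqNgt; apply/negP => hji.
  by apply: (he i j k) => //; left.
have eE : e = nseq (firstJ e) 0 ++ drop (firstJ e) e by apply: cat_nseq_find.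
have := @wordJ_exists n 1 (drop (firstJ e) e) isT; case.
- exact: goodJ_drop.
- move=> i; rewrite size_drop nth_drop se => h.
  have := hi (firstJ e + i); lia.
- case: (boolP (has (predC1 0) e)) => [h|].
    by have := nth_find 1 h; rewrite /= -/(firstJ _) -nth0 nth_drop addn0; lia.
  by rewrite has_find -leqNgt -/(firstJ _) => h; rewrite drop_oversize.
by move=> l [sl hl lE]; exists l; rewrite -lE.
Qed.

(** The exponents of a normal form are determined by [phiJ], the number of
    leading zeros by the length. *)
Lemma invseqJ_phiJ n e : classJ n.+1 e -> invseqJ (phiJ e) = e.
Proof.
move=> ce; have [l [sl hl eE]] := classJ_normal ce.
have se : size e = n.+1 by case: ce => -[].
have phE : phiJ e = rev [seq (x.1%:Z, 1 - x.2%:Z)%R | x <- l].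
  by rewrite eE phiJE // -eE sl.
have pE : pairsJ (phiJ e) = l.
  rewrite phE /pairsJ map_rev revK -map_comp -[RHS]map_id; apply/eq_map => -[a b] /=.
  by congr (_, _); lia.
rewrite /invseqJ pE [RHS]eE; congr (nseq _ _ ++ _).
have sp : size (phiJ e) = n by rewrite phE size_rev size_map.
have st : all (fun s : step => (0 <= s.1) && (s.2 <= 1))%R (phiJ e).
  by rewrite phE all_rev all_map; apply/allP => -[a b] _ /=; lia.
have := size_wordJ_pairsJ 1 st; rewrite pE sp.
by have := congr1 size eE; rewrite size_cat size_nseq se; lia.
Qed.

Lemma psiJ_invseqJ Q : Fpath Q -> psiJ Q = invseqJ Q.
Proof.
move=> FQ; rewrite /psiJ -[X in 'pinv_ _ _ _ X](phiJ_invseqJ FQ).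
rewrite (pinv_cancel _ (@invseqJ_phiJ (size Q))) //; exact: classJ_invseqJ.
Qed.

Lemma psiJ_dsumF Q R : Fpath Q -> Fpath R ->
  psiJ (dsumF Q R) = dsumJ (psiJ Q) (psiJ R).
Proof.
move=> FQ FR; rewrite !psiJ_invseqJ ?Fpath_dsumF //; exact: invseqJ_dsumF.
Qed.

(** * Inversion sequences avoiding 101 and 102 *)

(** Inverts one recursive call of phi_I: the new rightmost maximum has value
    max + s.1 and 1-based position prmx + s.2. *)
Definition stepI (e : seq nat) (s : step) : seq nat :=
  let q := `|((prmx e)%:Z + s.2 - 1)%R|%N in
  take q e ++ `|((maxI e)%:Z + s.1)%R|%N :: drop q e.

Definition invseqI (Q : seq step) : seq nat := foldl stepI [:: 0] Q.

Lemma all_ltnW M (y : seq nat) : all (ltn^~ M) y -> all (leq^~ M) y.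
Proof. by apply: sub_all => u /ltnW. Qed.

Lemma maxI_split x M y : all (leq^~ M) x -> all (ltn^~ M) y ->
  maxI (x ++ M :: y) = M.
Proof.
move=> /allP xM /all_ltnW/allP yM; apply/eqP; rewrite eqn_leq; apply/andP; split.
  apply/bigmax_leqP_seq => v; rewrite mem_cat inE => /orP[/xM //|] /orP[/eqP ->//|/yM //].
by rewrite /maxI big_cat big_cons /= !leq_max leqnn orbT.
Qed.

(** Writing e = x M y with x <= M and y < M displays both the maximum and its
    rightmost occurrence. *)
Lemma prmx_split x M y : all (leq^~ M) x -> all (ltn^~ M) y ->
  prmx (x ++ M :: y) = (size x).+1.
Proof.
move=> xM yM; rewrite /prmx maxI_split //.
have My : M \notin y by apply/negP => /(allP yM) /=; rewrite ltnn.
rewrite rev_cat rev_cons index_cat mem_rcons in_cons eqxx /=.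
rewrite -cats1 index_cat mem_rev (negPf My) /= eqxx addn0 size_rev size_cat /=.
lia.
Qed.

Lemma maxI_splitP (e : seq nat) : e != [::] -> exists x y,
  [/\ e = x ++ maxI e :: y, all (leq^~ (maxI e)) x & all (ltn^~ (maxI e)) y].
Proof.
suff h : e != [::] -> exists x M y,
  [/\ e = x ++ M :: y, all (leq^~ M) x & all (ltn^~ M) y].
  move=> /h[x [M [y [eE xM yM]]]]; exists x, y.
  by rewrite eE maxI_split.
elim: e => // v e IH _; case: (eqVneq e [::]) => [->|/IH]; first by exists [::], v, [::].
case=> x [M [y [eE xM yM]]]; case: (leqP v M) => vM.
  by exists (v :: x), M, y; rewrite eE /= vM.
exists [::], v, e; split=> //; rewrite eE all_cat /= vM.
by apply/andP; split; apply/allP => u; [move/(allP xM)|move/(allP yM)] => /=; lia.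
Qed.

Lemma dsumI_split x M y f : all (leq^~ M) x -> all (ltn^~ M) y ->
  dsumI (x ++ M :: y) f = x ++ M :: [seq v + M | v <- f] ++ y.
Proof.
move=> xM yM; rewrite /dsumI prmx_split // maxI_split // -cat_rcons.
by rewrite take_size_cat ?drop_size_cat ?size_rcons // cat_rcons.
Qed.

Lemma hatI_split x M y : all (leq^~ M) x -> all (ltn^~ M) y ->
  hatI (x ++ M :: y) = x ++ y.
Proof.
move=> xM yM; rewrite /hatI prmx_split //= take_size_cat //.
by rewrite -cat_rcons drop_size_cat // size_rcons.
Qed.

Lemma prmx_le_size e : prmx e <= size e.
Proof. exact: leq_subr. Qed.

Lemma dsumI_maxE (e f : seq nat) : e != [::] -> f != [::] ->
  maxI (dsumI e f) = maxI e + maxI f /\ prmx (dsumI e f) = prmx e + prmx f.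
Proof.
move=> /maxI_splitP[x [y [eE xM yM]]] /maxI_splitP[x' [y' [fE xM' yM']]].
move: (maxI e) (maxI f) eE fE xM yM xM' yM' => M M' -> -> xM yM xM' yM'.
rewrite dsumI_split // (prmx_split xM yM) (prmx_split xM' yM').
rewrite map_cat /= -catA /= -cat_cons catA.
have hx : all (leq^~ (M' + M)) (x ++ M :: [seq v + M | v <- x']).
  rewrite all_cat /= leq_addl all_map; apply/andP; split.
    by apply: sub_all xM => u /= ?; lia.
  by apply: sub_all xM' => u /= ?; lia.
have hy : all (ltn^~ (M' + M)) ([seq v + M | v <- y'] ++ y).
  rewrite all_cat all_map; apply/andP; split.
    by apply: sub_all yM' => u /= ?; lia.
  by apply: sub_all yM => u /= ?; lia.
rewrite prmx_split // maxI_split //.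
by rewrite size_cat /= size_map; lia.
Qed.

Lemma stepI_neq0 e s : stepI e s != [::].
Proof. by rewrite /stepI; case: (take _ _). Qed.

Lemma invseqI_neq0 Q : invseqI Q != [::].
Proof. by case/lastP: Q => // Q s; rewrite /invseqI foldl_rcons stepI_neq0. Qed.

(** The rightmost maximum of a direct sum lies inside the copy of the second
    summand, at an offset prmx e and raised by max e, so the insertion takes place
    inside that copy. *)
Lemma stepI_dsumI (e f : seq nat) (s : step) : e != [::] -> f != [::] ->
  (0 <= s.1)%R -> (s.2 <= 1)%R -> (1 - s.2 <= (prmx f)%:Z)%R ->
  stepI (dsumI e f) s = dsumI e (stepI f s).
Proof.
case: s => a b e0 f0 /= a0 b1 hb; have [mE pE] := dsumI_maxE e0 f0.
rewrite {1}/stepI mE pE /= {1}/stepI /=.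
set q := absz ((prmx f)%:Z + b - 1)%R.
have qE : (q%:Z = (prmx f)%:Z + b - 1)%R by rewrite /q; lia.
have qf : q <= size f by have := prmx_le_size f; lia.
have -> : `|((prmx e + prmx f)%N%:Z + b - 1)%R|%N = prmx e + q by lia.
have -> : `|((maxI e + maxI f)%N%:Z + a)%R|%N = `|((maxI f)%:Z + a)%R|%N + maxI e by lia.
have pe : size (take (prmx e) e) = prmx e by rewrite size_takel // prmx_le_size.
set A := take (prmx e) e in pe *; set y := drop (prmx e) e.
set F := [seq v + maxI e | v <- f].
have -> : dsumI e f = A ++ F ++ y by [].
have sF : size F = size f by rewrite size_map.
have -> : take (prmx e + q) (A ++ F ++ y) = A ++ take q F.
  by rewrite take_cat pe ltnNge leq_addr /= addKn takel_cat ?sF.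
have -> : drop (prmx e + q) (A ++ F ++ y) = drop q F ++ y.
  rewrite drop_cat pe ltnNge leq_addr /= addKn drop_cat sF; case: ltnP => // fq.
  by rewrite (_ : q - size f = 0) ?drop0 ?drop_oversize ?sF //; lia.
by rewrite /dsumI map_cat /= map_take map_drop -!catA.
Qed.

(** The patterns 101 and 102 together forbid e_j < e_i <= e_k. *)
Lemma classIE n e : size e = n ->
  (forall i, i < n -> nth 0 e i <= i) ->
  (forall i j k, i < j -> j < k -> k < n ->
     nth 0 e j < nth 0 e i -> nth 0 e i <= nth 0 e k -> False) ->
  classI n e.
Proof.
move=> se e1 e2; split; first by split=> // i ni; rewrite ltnS e1.
move=> i j k ij jk kn [[h1 h2]|[h1 h2]]; apply: (e2 i j k) => //; lia.
Qed.

Lemma classI_pattern n e i j k : classI n e -> i < j -> j < k -> k < n ->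
  nth 0 e j < nth 0 e i -> nth 0 e i <= nth 0 e k -> False.
Proof.
case=> _ h ij jk kn h1; rewrite leq_eqVlt => /orP[/eqP h2|h2].
  by apply: (h i j k) => //; left.
by apply: (h i j k) => //; right.
Qed.

Lemma nth_insert (e : seq nat) q M i : q <= size e ->
  nth 0 (take q e ++ M :: drop q e) i =
  if i < q then nth 0 e i else if i == q then M else nth 0 e i.-1.
Proof.
move=> qe; rewrite nth_cat size_takel //; case: ltnP => [iq|qi].
  by rewrite nth_take.
case: eqP => [->|iq]; first by rewrite subnn.
have -> : i - q = (i.-1 - q).+1 by lia.
by rewrite /= nth_drop subnKC //; lia.
Qed.

(** The entries up to the rightmost maximum are weakly increasing, as otherwise a
    descent among them would form a pattern with the maximum. Since the new entry is
    placed at most one place after the old maximum, it cannot be the last letter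
    of a pattern; it cannot be the first or middle one because it is
    larger than everything after it and at least as large as everything before. *)
Lemma stepI_spec n e s : classI n.+1 e -> inF s ->
  ((maxI e)%:Z + s.1 <= (prmx e)%:Z - 1 + s.2)%R ->
  [/\ classI n.+2 (stepI e s), ((maxI (stepI e s))%:Z = (maxI e)%:Z + s.1)%R,
      ((prmx (stepI e s))%:Z = (prmx e)%:Z + s.2)%R & hatI (stepI e s) = e].
Proof.
case: s => a b ce Fs /= hM.
have se : size e = n.+1 by case: ce => -[].
have e0 : e != [::] by case: (e) se.
have [x [y [eE xM yM]]] := maxI_splitP e0.
have pE : prmx e = (size x).+1 by rewrite eE prmx_split.
set M := maxI e in hM eE xM yM *.
have eM : all (leq^~ M) e by rewrite eE all_cat /= leqnn xM all_ltnW.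
have a0 : (0 <= a)%R by case: (inFP Fs) => [[-> _]//|[/=]]; lia.
have b1 : (b <= 1)%R by case: (inFP Fs) => [[_ ->]//|[/=]]; lia.
rewrite /stepI /= -/M; set q := absz (_ + b - 1)%R; set N := absz (M%:Z + a)%R.
have NE : (N%:Z = M%:Z + a)%R by rewrite /N; lia.
have qE : (q%:Z = (prmx e)%:Z + b - 1)%R by rewrite /q; lia.
have qp : q <= prmx e by lia.
have qe : q <= size e by apply: leq_trans qp (prmx_le_size e).
have Nq : N <= q by lia.
have hx : all (leq^~ N) (take q e).
  apply/allP => u /mem_take /(allP eM) /=; lia.
have hy : all (ltn^~ N) (drop q e).
  case: (inFP Fs) => [[a1 b2]|[/= a1 _]].
    have -> : N = M by lia.
    have -> : q = size (rcons x M) by rewrite size_rcons; lia.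
    by rewrite eE -cat_rcons drop_size_cat.
  by apply/allP => u /mem_drop /(allP eM) /=; lia.
rewrite maxI_split // prmx_split // hatI_split // size_takel // cat_take_drop.
clearbody q N; split=> //; last by lia.
apply: classIE => [|i iN|i j k ij jk kn].
- by rewrite size_cat /= size_takel // size_drop se; lia.
- rewrite nth_insert //; case: ltnP => iq; last case: eqP => [->//|/eqP iq'].
    by case: ce => -[_ h _]; rewrite -ltnS h //; lia.
  by case: ce => -[_ h _]; have := h i.-1; lia.
rewrite !nth_insert //.
(* The three cases below are those of the new entry as last, first and middle
   letter of a pattern. *)
have le_M u : nth 0 e u <= M.
  by case: (ltnP u (size e)) => ue; [exact: (allP eM) (mem_nth 0 ue) | rewrite nth_default].
have mono u v : u < v -> v < q -> nth 0 e u <= nth 0 e v.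
  move=> uv vq; rewrite leqNgt; apply/negP => h.
  case: (ltnP v (size x)) => vx; last first.
    have vE : v = size x by lia.
    have : nth 0 e v = M by rewrite vE {1}eE nth_cat ltnn subnn.
    by have := le_M u; lia.
  have xe : size x < n.+1 by rewrite -se eE size_cat /=; lia.
  apply: (classI_pattern ce uv vx xe h).
  by rewrite {2}eE nth_cat ltnn subnn.
have big u : q <= u -> u < n.+1 -> nth 0 e u < N.
  move=> qu un; have := nth_drop q 0 e (u - q); rewrite subnKC // => <-.
  by apply: (allP hy); apply: mem_nth; rewrite size_drop se; lia.
case: (eqVneq k q) => [kq|kq].
  have [-> ->] : (i < q) /\ (j < q) by lia.
  by rewrite kq ltnn => h _; have := mono i j ij; lia.
case: (eqVneq i q) => [iq|iq].
  have [-> ->] : (i < q) = false /\ (k < q) = false by lia.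
  by move=> _; have := big k.-1; lia.
case: (eqVneq j q) => [jq|jq].
  have -> : i < q by lia.
  by rewrite jq ltnn; have := le_M i; lia.
(* A pattern that avoids the new entry is a pattern of e. *)
pose d u := if u < q then u else u.-1.
have E u : (if u < q then nth 0 e u else nth 0 e u.-1) = nth 0 e (d u).
  by rewrite /d; case: ifP.
rewrite !E; apply: (classI_pattern ce); rewrite /d.
- by case: (ltnP i q); case: (ltnP j q); lia.
- by case: (ltnP k q); case: (ltnP j q); lia.
- by case: (ltnP k q); lia.
Qed.

(** The entries after the rightmost maximum move one place to the left; they remain
    admissible since they are smaller than the maximum, which itself is
    at most its 0-based position. *)
Lemma classI_hat n e : classI n.+2 e -> classI n.+1 (hatI e).
Proof.
move=> ce; have se : size e = n.+2 by case: ce => -[].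
have e0 : e != [::] by case: (e) se.
have [x [y [eE xM yM]]] := maxI_splitP e0.
set M := maxI e in eE xM yM *.
have xe : size x < n.+2 by rewrite -se eE size_cat /=; lia.
have eM : nth 0 e (size x) = M by rewrite {1}eE nth_cat ltnn subnn.
have hE : hatI e = x ++ y by rewrite eE hatI_split.
pose d u := if u < size x then u else u.+1.
have hn u : nth 0 (x ++ y) u = nth 0 e (d u).
  rewrite eE /d !nth_cat; case: ltnP => ux; first by rewrite ux.
  by rewrite ltnNge (leq_trans ux) // subSn.
case: (ce) => -[_ he] _; rewrite hE; apply: classIE => [|i iN|i j k ij jk kn].
- by have := se; rewrite eE !size_cat /=; lia.
- rewrite hn /d; case: ltnP => ix; first by rewrite -ltnS he //; lia.
  have : nth 0 e i.+1 < M.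
    have -> : nth 0 e i.+1 = nth 0 y (i - size x).
      by rewrite {1}eE nth_cat ltnNge (leq_trans ix) //= subSn.
    apply: (allP yM); apply: mem_nth.
    by have := se; rewrite eE size_cat /=; lia.
  by have := he _ xe; rewrite eM; lia.
rewrite !hn; apply: (classI_pattern ce); rewrite /d.
- by case: (ltnP i (size x)); case: (ltnP j (size x)); lia.
- by case: (ltnP k (size x)); case: (ltnP j (size x)); lia.
- by case: (ltnP k (size x)); lia.
Qed.

Lemma stepI_hatI (e : seq nat) :
  e != [::] ->
  stepI (hatI e) ((maxI e)%:Z - (maxI (hatI e))%:Z,
                  (prmx e)%:Z - (prmx (hatI e))%:Z)%R = e.
Proof.
move=> /maxI_splitP[x [y [eE xM yM]]]; set M := maxI e in eE xM yM *.
have hE : hatI e = x ++ y by rewrite eE hatI_split.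
have pE : prmx e = (size x).+1 by rewrite eE prmx_split.
rewrite /stepI hE pE /=.
have -> : `|((maxI (x ++ y))%:Z + (M%:Z - (maxI (x ++ y))%:Z))%R|%N = M by lia.
set q := absz _; have -> : q = size x by rewrite /q; lia.
by rewrite take_size_cat // drop_size_cat.
Qed.

Lemma phiI_hat n e : size e = n.+2 -> size (hatI e) = n.+1 -> phiI e =
  rcons (phiI (hatI e)) ((maxI e)%:Z - (maxI (hatI e))%:Z,
                         (prmx e)%:Z - (prmx (hatI e))%:Z)%R.
Proof. by rewrite /phiI => -> ->. Qed.

Lemma invseqI_phiI n e : classI n.+1 e -> invseqI (phiI e) = e.
Proof.
elim: n e => [|n IH] e ce.
  have [[se he] _] := ce; case: e se he {ce} => // v [|//] _ /(_ 0 isT) /=.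
  by rewrite ltnS leqn0 => /eqP ->.
have ch := classI_hat ce; have [[se _] _] := ce; have [[sh _] _] := ch.
rewrite (phiI_hat se sh) /invseqI foldl_rcons -/(invseqI _) IH // stepI_hatI //.
by case: (e) se.
Qed.

(** The maximum and its position record the endpoint of Q, shifted by (0,1); the
    inversion condition for the new maximum is then the condition x <= y on
    the path. *)
Lemma invseqI_spec Q : Fpath Q -> 
  [/\ classI (size Q).+1 (invseqI Q), phiI (invseqI Q) = Q,
     ((maxI (invseqI Q))%:Z = (endpoint Q).1)%R &
     ((prmx (invseqI Q))%:Z = (endpoint Q).2 + 1)%R].
Proof.
move: Q; apply: Fpath_ind => [|Q s FQ Fs h [ce pE mE rE]].
  rewrite endpoint_nil /invseqI /=; split=> //.
  - by apply: classIE => [|[|i]|i [|j] [|k]].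

  - by rewrite /maxI big_seq1.
  - by rewrite /prmx /maxI big_seq1.
have [|ce' mE' rE' hE] := stepI_spec ce Fs.
  by move: h; rewrite /ht; lia.
rewrite /invseqI foldl_rcons -/(invseqI Q) size_rcons endpoint_rcons /=; split=> //; try lia.
have [[se _] _] := ce; have [[se' _] _] := ce'.
rewrite (phiI_hat se') hE // pE; congr rcons.
by case: s {Fs h ce' hE se'} mE' rE' => a b /= mE' rE'; congr (_, _); lia.
Qed.

Lemma psiI_invseqI Q : Fpath Q -> psiI Q = invseqI Q.
Proof.
move=> FQ; have [ce pE _ _] := invseqI_spec FQ.
rewrite /psiI -[X in 'pinv_ _ _ _ X]pE.
by rewrite (pinv_cancel _ (@invseqI_phiI (size Q))).
Qed.

Lemma psiI_dsumF Q R : Fpath Q -> Fpath R ->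
  psiI (dsumF Q R) = dsumI (psiI Q) (psiI R).
Proof.
move=> FQ FR; rewrite !psiI_invseqI ?Fpath_dsumF //; move: Q R FQ FR.
apply: (@foldl_dsumF _ stepI [:: 0]) => [Q FQ|Q R s FQ FR Fs h]; rewrite -/(invseqI _).
  rewrite /stepI /dsumI /= add0n; congr (take _ _ ++ _ :: drop _ _); lia.
have [_ _ mE rE] := invseqI_spec FR.
rewrite stepI_dsumI ?invseqI_neq0 // -/(invseqI R); move: h; rewrite /ht.
all: by case: (inFP Fs) => [->//|[]] /=; lia.
Qed.

(** * Schroeder paths *)

Lemma schroederP P : reflect
  ((forall i, count_mem Pd (take i P) <= count_mem Pu (take i P)) /\
   count_mem Pd P = count_mem Pu P) (schroeder P).
Proof.
apply: (iffP andP) => [[/allP h /eqP e]|[h /eqP e]]; split=> //.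
  move=> i; case: (ltnP i (size P)) => iP; first by apply: h; rewrite mem_iota.
  by rewrite take_oversize // e.
by apply/allP => i _; apply: h.
Qed.

Lemma schroeder_bal P : schroeder P -> count_mem Pd P = count_mem Pu P.
Proof. by case/schroederP. Qed.

Lemma schroeder_cat X Y : schroeder X -> schroeder Y -> schroeder (X ++ Y).
Proof.
move=> /schroederP[hX eX] /schroederP[hY eY]; apply/schroederP.
split=> [i|]; last by rewrite !count_cat eX eY.
by rewrite take_cat; case: ltnP => // _; rewrite !count_cat eX leq_add2l.
Qed.

Lemma schroeder_h : schroeder [:: Ph]. Proof. by []. Qed.

Lemma schroeder_wrap Y : schroeder Y -> schroeder (Pu :: Y ++ [:: Pd]).
Proof.
move=> /schroederP[hY eY]; apply/schroederP; split=> [[//|i]|]; last first.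
  by rewrite -cat1s !count_cat eY /=; lia.
rewrite [take _ _]/= -(cat1s Pu) !count_cat take_cat.
case: ltnP => _; first by have := hY i; rewrite /=; lia.
by rewrite !count_cat eY; case: (i - size Y) => [|k] /=; lia.
Qed.

Lemma hox_cat X Y : schroeder X -> hox (X ++ Y) = hox X + hox Y.
Proof.
move=> /schroeder_bal eX; rewrite /hox size_cat iotaD count_cat; congr (_ + _).
  apply: eq_in_count => i; rewrite mem_iota add0n => /andP[_ iX].
  by rewrite nth_cat iX takel_cat // ltnW.
rewrite add0n -[X in iota X _]addn0 iotaDl count_map; apply: eq_count => i /=.
rewrite nth_cat take_cat ltnNge leq_addr /= addKn !count_cat eX.
by rewrite eqn_add2l.
Qed.

Lemma hox_wrap Y : schroeder Y -> hox (Pu :: Y ++ [:: Pd]) = 0.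
Proof.
move=> /schroederP[hY eY]; apply/eqP; rewrite -leqn0 leqNgt -has_count.
apply/hasPn => -[|i] //= _; rewrite take_cat nth_cat; case: ltnP => iY.
  by have := hY i; case: eqP => //=; lia.
by case: (i - size Y) => [|[|k]].
Qed.

Lemma hox_cat_wrap X Y : schroeder X -> schroeder Y ->
  hox (X ++ Pu :: Y ++ [:: Pd]) = hox X.
Proof. by move=> sX sY; rewrite hox_cat // hox_wrap // addn0. Qed.

Lemma hox_h : hox [:: Ph] = 1. Proof. by []. Qed.

Lemma cat_h X Y : X ++ Ph :: Y = X ++ [:: Ph] ++ Y. Proof. by []. Qed.

Lemma schroeder_hcat X Y : schroeder X -> schroeder Y -> schroeder (X ++ Ph :: Y).
Proof. by move=> sX sY; rewrite cat_h !schroeder_cat. Qed.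

(** Each h step on the axis cuts a Schroeder path into two, which makes hox additive
    and identifies the decompositions P = XhY by the value of hox(Y). *)
Lemma hox_hcat X Y : schroeder X -> hox (X ++ Ph :: Y) = hox X + (hox Y).+1.
Proof. by move=> sX; rewrite hox_cat // -cat1s hox_cat. Qed.

Lemma schroeder_take_drop i P : schroeder P -> schroeder (take i P) ->
  schroeder (drop i P).
Proof.
move=> /schroederP[hP eP] /schroederP[_ ei]; apply/schroederP; split=> [j|].
  by have := hP (i + j); rewrite takeD !count_cat ei leq_add2l.
by move: eP; rewrite -{1 2}(cat_take_drop i P) !count_cat ei => /addnI.
Qed.

(** Uniqueness of the decomposition XhY with given hox(Y): an earlier cut would
    leave the displayed h on the axis to its right, and so give a larger hox. *)
Lemma hsplit_hox X Y : schroeder X -> schroeder Y ->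
  hsplit (hox Y) (X ++ Ph :: Y) = (X, Y).
Proof.
move=> sX sY; rewrite /hsplit (@find_iota _ _ (size X)).
- by rewrite take_size_cat // -cat_rcons drop_size_cat // size_rcons.
- by rewrite size_cat /= addnS ltnS leq_addr.
- rewrite nth_cat ltnn subnn take_size_cat // -cat_rcons drop_size_cat ?size_rcons //.
  by rewrite /= sX sY eqxx.
move=> j jX; apply/negP; case/and4P => /eqP jh sj _ /eqP.
have sj1 : schroeder (take j.+1 X).
  rewrite (take_nth Pu) // -cats1 schroeder_cat //; first by rewrite takel_cat 1?ltnW in sj.
  by move: jh; rewrite nth_cat jX => ->.
have -> : drop j.+1 (X ++ Ph :: Y) = drop j.+1 X ++ Ph :: Y.
  by rewrite -{1}(cat_take_drop j.+1 X) -catA drop_size_cat ?size_takel.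
by rewrite hox_hcat ?schroeder_take_drop //; lia.
Qed.

(** Cut at any h on the axis, and look for the required one on the side on which
    hox places it. *)
Lemma schroeder_hsplit k P : schroeder P -> k < hox P -> exists X Y,
  [/\ schroeder X, schroeder Y, hox Y = k & P = X ++ Ph :: Y].
Proof.
have [n] := ubnP (size P); elim: n P k => // n IH P k Pn sP kP.
have := leq_ltn_trans (leq0n k) kP; rewrite -has_count.
case/hasP=> i; rewrite mem_iota => /andP[_ iP] /andP[/eqP ih /eqP ib].
have sX : schroeder (take i P).
  apply/schroederP; split=> // j; case/schroederP: sP => hP _.
  by rewrite -take_min hP.
have PE : P = take i P ++ Ph :: drop i.+1 P by rewrite -ih -drop_nth ?cat_take_drop.
move: (take i P) (drop i.+1 P) PE sX => X Z PE sX {ih ib}.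
have sZ : schroeder Z.
  have sXh : schroeder (take (size X).+1 P).
    by rewrite PE -cat_rcons take_size_cat ?size_rcons // -cats1 schroeder_cat.
  have := schroeder_take_drop sP sXh.
  by rewrite {1}PE -cat_rcons drop_size_cat // size_rcons.
have sz : size P = size X + (size Z).+1 by rewrite PE size_cat.
have hE : hox P = hox X + (hox Z).+1 by rewrite PE hox_hcat.
case: (ltngtP k (hox Z)) => [kZ|Zk|->]; last by exists X, Z.
- have [|X' [Y' [sX' sY' hY' ZE]]] := IH Z k _ sZ kZ; first by lia.
  exists (X ++ Ph :: X'), Y'; split=> //; first exact: schroeder_hcat.
  by rewrite PE ZE -catA.
have [||X' [Y' [sX' sY' hY' XE]]] := IH X (k - (hox Z).+1) _ sX; try lia.
exists X', (Y' ++ Ph :: Z); split=> //; first exact: schroeder_hcat.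
  by rewrite hox_hcat // hY'; lia.
by rewrite PE XE -catA.
Qed.

(** The graph of the recursive rule, with the decompositions as data: in this form
    a decomposition of P2 can be extended to one of P1 (+) P2. *)
Variant stepP_spec (P : seq pstep) (s : step) : seq pstep -> Prop :=
| StepPh of s = (0, 1)%R : stepP_spec P s (P ++ [:: Ph])
| StepPud of s = (1, 1)%R : stepP_spec P s (P ++ [:: Pu; Pd])
| StepPu X Y of P = X ++ Ph :: Y & schroeder X & schroeder Y
    & (s = ((hox Y)%:Z + 2, 1))%R :
    stepP_spec P s (X ++ Pu :: Y ++ [:: Ph; Pd])
| StepPd X Z of P = X ++ Ph :: Z & schroeder X & schroeder Z
    & (s = (1, - (hox Z)%:Z))%R :
    stepP_spec P s (X ++ Pu :: Z ++ [:: Pu; Pd; Pd])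
| StepPud2 X Y Z of P = X ++ Ph :: Y ++ Ph :: Z & schroeder X & schroeder Y & schroeder Z
    & (s = ((hox Y)%:Z + 2, - (hox Z)%:Z))%R :
    stepP_spec P s (X ++ Pu :: Y ++ Pu :: Z ++ [:: Ph; Pd; Pd]).

(** The relation is functional because decompositions are unique. *)
Lemma stepP_unique P s P' : stepP_spec P s P' -> stepP P s = P'.
Proof.
case=> [->|->|X Y -> sX sY ->|X Z -> sX sZ ->|X Y Z -> sX sY sZ ->] //; rewrite /stepP.
- have -> : ((hox Y)%:Z + 2 == 0 :> int)%R = false by lia.
  have -> : ((hox Y)%:Z + 2 == 1 :> int)%R = false by lia.
  have -> : `|((hox Y)%:Z + 2 - 2)%R|%N = hox Y by lia.
  by rewrite hsplit_hox.
- have -> : (- (hox Z)%:Z == 1 :> int)%R = false by lia.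
  have -> : `|(- (hox Z)%:Z)%R|%N = hox Z by lia.
  by rewrite hsplit_hox.
have -> : ((hox Y)%:Z + 2 == 0 :> int)%R = false by lia.
have -> : ((hox Y)%:Z + 2 == 1 :> int)%R = false by lia.
have -> : (- (hox Z)%:Z == 1 :> int)%R = false by lia.
have -> : `|((hox Y)%:Z + 2 - 2)%R|%N = hox Y by lia.
have -> : `|(- (hox Z)%:Z)%R|%N = hox Z by lia.
by rewrite -(cat_cons Ph) catA hsplit_hox ?schroeder_hcat // hsplit_hox.
Qed.

Lemma stepP_specP P s : schroeder P -> inF s -> (s.1 - s.2 <= (hox P)%:Z)%R ->
  stepP_spec P s (stepP P s).
Proof.
move=> sP Fs hs; suff [P' sp] : exists P', stepP_spec P s P'.
  by rewrite (stepP_unique sp).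
case: s Fs hs => a b Fs /= hs; case: (inFP Fs) => [[-> ->]|[/= a1 b1]].
  by eexists; apply: StepPh.
have [b1'|b0] : b = 1 \/ (b <= 0)%R by lia.
  have [a1'|a2] : a = 1 \/ (2 <= a)%R by lia.
    by rewrite a1' b1'; eexists; apply: StepPud.
  have [|X [Y [sX sY hY PE]]] := @schroeder_hsplit `|(a - 2)%R|%N P sP; first by lia.
  by eexists; apply: (StepPu PE) => //; congr (_, _); lia.
have [|W [Z [sW sZ hZ PE]]] := @schroeder_hsplit `|b|%N P sP; first by lia.
have [a1'|a2] : a = 1 \/ (2 <= a)%R by lia.
  by eexists; apply: (StepPd PE) => //; congr (_, _); lia.
have hE : hox P = hox W + (hox Z).+1 by rewrite PE hox_hcat.
have [|X [Y [sX sY hY WE]]] := @schroeder_hsplit `|(a - 2)%R|%N W sW; first by lia.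
eexists; apply: (@StepPud2 _ _ X Y Z) => //; first by rewrite PE WE -catA.
by congr (_, _); lia.
Qed.

(** The summand P1 h is absorbed by the leftmost factor X. *)
Lemma stepP_dsumP P1 P2 s P' : schroeder P1 -> stepP_spec P2 s P' ->
  stepP_spec (dsumP P1 P2) s (dsumP P1 P').
Proof.
move=> s1; rewrite /dsumP.
have catE X W : P1 ++ Ph :: X ++ W = (P1 ++ Ph :: X) ++ W by rewrite -catA.
case=> [->|->|X Y -> sX sY ->|X Z -> sX sZ ->|X Y Z -> sX sY sZ ->].
- by rewrite catE; apply: StepPh.
- by rewrite catE; apply: StepPud.
- by rewrite !catE; apply: StepPu => //; apply: schroeder_hcat.
- by rewrite !catE; apply: StepPd => //; apply: schroeder_hcat.
- by rewrite !catE; apply: StepPud2 => //; apply: schroeder_hcat.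
Qed.

(** A factor wrapped between u and d no longer meets the axis, and the h in front of
    it has become u. *)
Lemma stepP_hox P s P' : schroeder P -> stepP_spec P s P' ->
  schroeder P' /\ ((hox P')%:Z = (hox P)%:Z + s.2 - s.1)%R.
Proof.
move=> sP; have hud : schroeder [:: Pu; Pd] by [].
case=> [->|->|X Y -> sX sY ->|X Z -> sX sZ ->|X Y Z -> sX sY sZ ->] /=.
- by rewrite schroeder_cat // hox_cat // hox_h; split=> //; lia.
- by rewrite schroeder_cat // hox_cat //; split=> //; rewrite /hox /=; lia.
- have -> : Pu :: Y ++ [:: Ph; Pd] = Pu :: (Y ++ [:: Ph]) ++ [:: Pd] by rewrite -catA.
  have sw := schroeder_cat sY schroeder_h.
  by rewrite schroeder_cat ?schroeder_wrap // hox_cat_wrap // hox_hcat //; split=> //; lia.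
- have -> : Pu :: Z ++ [:: Pu; Pd; Pd] = Pu :: (Z ++ [:: Pu; Pd]) ++ [:: Pd] by rewrite -catA.
  have sw := schroeder_cat sZ hud.
  by rewrite schroeder_cat ?schroeder_wrap // hox_cat_wrap // hox_hcat //; split=> //; lia.
have -> : Pu :: Y ++ Pu :: Z ++ [:: Ph; Pd; Pd] =
    Pu :: (Y ++ (Pu :: (Z ++ [:: Ph]) ++ [:: Pd])) ++ [:: Pd].
  by rewrite -!catA /= -!catA.
have sw := schroeder_cat sY (schroeder_wrap (schroeder_cat sZ schroeder_h)).
rewrite schroeder_cat ?schroeder_wrap // hox_cat_wrap // !hox_hcat //; split=> //; lia.
Qed.

Lemma psiP_hox Q : Fpath Q -> schroeder (psiP Q) /\ ((hox (psiP Q))%:Z = ht Q)%R.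
Proof.
move: Q; apply: Fpath_ind => [|Q s FQ Fs h [sQ hQ]]; first by rewrite /ht endpoint_nil.
rewrite ht_rcons /psiP foldl_rcons -/(psiP Q) -hQ.
by apply: stepP_hox => //; apply: stepP_specP; rewrite ?hQ.
Qed.

Lemma psiP_dsumF Q R : Fpath Q -> Fpath R ->
  psiP (dsumF Q R) = dsumP (psiP Q) (psiP R).
Proof.
apply: foldl_dsumF => [{}Q FQ //|{}Q {}R s FQ FR Fs h].
rewrite -/(psiP Q) -/(psiP R); have [sQ _] := psiP_hox FQ; have [sR hR] := psiP_hox FR.
by apply/stepP_unique/stepP_dsumP/stepP_specP; rewrite ?hR.
Qed.

(** * Permutations *)

Lemma dsumS0 p : dsumS p [::] = p. Proof. exact: cats0. Qed.

Lemma dsum0S p : dsumS [::] p = p.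
Proof. by rewrite /dsumS (eq_map (g := id)) ?map_id // => v; apply: addn0. Qed.

Lemma size_dsumS p q : size (dsumS p q) = size p + size q.
Proof. by rewrite size_cat size_map. Qed.

Lemma dsumSA p q r : dsumS p (dsumS q r) = dsumS (dsumS p q) r.
Proof.
rewrite {2 3}/dsumS size_dsumS {1}/dsumS map_cat -map_comp -catA; congr (_ ++ _ ++ _).
by apply: eq_map => v /=; lia.
Qed.

Lemma perm_iota_shift m p : permS p ->
  perm_eq [seq v + m | v <- p] (iota m.+1 (size p)).
Proof.
move=> pp; apply: perm_trans (perm_map _ pp) _; rewrite -[m.+1]addn1 iotaDl.
by rewrite (eq_map (g := addn m)) // => v; rewrite addnC.
Qed.

Lemma permS_dsumS p q : permS p -> permS q -> permS (dsumS p q).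
Proof.
move=> pp pq; rewrite /permS size_dsumS iotaD add1n /dsumS.
by apply: perm_cat => //; apply: perm_iota_shift.
Qed.

Lemma permS_mem p v : permS p -> (v \in p) = (0 < v <= size p).
Proof. by move=> /perm_mem ->; rewrite mem_iota add1n ltnS. Qed.

Lemma permS_uniq p : permS p -> uniq p.
Proof. by move=> /perm_uniq ->; apply: iota_uniq. Qed.

(** The values that occur after a cut i all exceed i, so that lowering them by i
    gives a permutation. *)
Lemma cutS_dsum w i : permS w -> cutS w i -> i <= size w ->
  exists p q, [/\ permS p, permS q, size p = i & w = dsumS p q].
Proof.
move=> pw ci iw; have si : size (take i w) = i by rewrite size_takel.
have pd : perm_eq (drop i w) (map (addn i) (iota 1 (size w - i))).
  rewrite -(perm_cat2l (take i w)) cat_take_drop.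
  by rewrite (permPr (perm_cat ci (perm_refl _))) -iota1D subnKC.
have ge v : v \in drop i w -> i <= v.
  by rewrite (perm_mem pd) => /mapP[u _ ->]; apply: leq_addr.
exists (take i w), (dropS i w); split=> //; first by rewrite /permS si.
  rewrite /permS size_map size_drop.
  apply: perm_trans (perm_map (subn^~ i) pd) _; rewrite -map_comp.
  by rewrite (@eq_map _ _ _ id) ?map_id // => u /=; rewrite addKn.
rewrite /dsumS -map_comp si -{1}(cat_take_drop i w); congr (_ ++ _).
by rewrite -[LHS]map_id; apply/eq_in_map => v /ge iv /=; rewrite subnK.
Qed.

Lemma dropS_dsumS p q : dropS (size p) (dsumS p q) = q.
Proof.
rewrite /dropS drop_size_cat // -map_comp (eq_map (g := id)) ?map_id // => v /=.
by rewrite addnK.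
Qed.

Lemma block_gt0 p : permS p -> p != [::] -> 0 < block p.
Proof.
move=> pp p0; rewrite /block -has_count; apply/hasP; exists (size p).
  by rewrite mem_iota add1n ltnS leqnn lt0n size_eq0 p0.
by rewrite /cutS take_size.
Qed.

Lemma block_eq0 p : permS p -> (block p == 0) = (p == [::]).
Proof.
move=> pp; case: (eqVneq p [::]) => [->|p0]; first by [].
by have := block_gt0 pp p0; lia.
Qed.

(** Uniqueness of the decomposition w = p (+) q with given block(q): a cut at an
    earlier place leaves at least one more block to its right. *)
Lemma ssplit_block p q : permS p -> permS q ->
  ssplit (block q) (dsumS p q) = size p.
Proof.
move=> pp pq; apply: find_iota; first by rewrite size_dsumS ltnS leq_addr.
  rewrite dropS_dsumS eqxx andbT /cutS take_size_cat //.
move=> i ip; apply/negP => /andP[ci /eqP].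
have pw := permS_dsumS pp pq.
have iw : i <= size (dsumS p q) by rewrite size_dsumS; lia.
have [u [v [pu pv su uvE]]] := cutS_dsum pw ci iw.
have cp : cutS p i by move: ci; rewrite /cutS /dsumS takel_cat // ltnW.
have [u' [v' [pu' pv' su' pE]]] := cutS_dsum pp cp (ltnW ip).
have uu' : u = u'.
  have := congr1 (take i) uvE; rewrite pE -dsumSA /dsumS.
  by rewrite -{1}su' -su !take_size_cat.
have vE : v = dsumS v' q.
  have := congr1 (dropS i) uvE; rewrite -{2}su dropS_dsumS pE -dsumSA.
  by rewrite -su' dropS_dsumS.
rewrite uvE -su dropS_dsumS vE block_cat // => /eqP.
have : v' != [::] by apply: contraTneq ip => v0; rewrite pE v0 dsumS0 su' ltnn.
by move/(block_gt0 pv'); lia.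
Qed.

(** Cut at any place where w splits, and look for the required cut on the side on
    which the number of blocks places it; a permutation that does not split has at
    most one block. *)
Lemma ssplit_exists m w : permS w -> m <= block w -> exists p q,
  [/\ permS p, permS q, block q = m & w = dsumS p q].
Proof.
have [n] := ubnP (size w); elim: n w m => // n IH w m wn pw mw.
case: (ltngtP m (block w)) mw => // [mw|->] _; last first.
  by exists [::], w; rewrite dsum0S.
case: (boolP (has (cutS w) (iota 1 (size w).-1))) => [/hasP[i]|].
  rewrite mem_iota => iw ci; have [|a [b [pa pb sa wE]]] := cutS_dsum pw ci; first by lia.
  have sw : size w = size a + size b by rewrite wE size_dsumS.
  have bw : block w = block a + block b by rewrite wE block_cat.
  case: (leqP m (block b)) => mb.
    have [|p [q [pp pq bq bE]]] := IH b m _ pb mb; first by lia.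
    exists (dsumS a p), q; rewrite permS_dsumS //; split=> //.
    by rewrite wE bE dsumSA.
  have [||p [q [pp pq bq aE]]] := IH a (m - block b) _ pa; try lia.
  exists p, (dsumS q b); rewrite permS_dsumS // block_cat // bq; split=> //; first by lia.
  by rewrite wE aE dsumSA.
rewrite has_count -leqNgt leqn0 => /eqP c0; exists w, [::]; rewrite dsumS0; split=> //.
case: (posnP (size w)) => w0; first by move: mw; rewrite (size0nil w0).
move: mw; rewrite /block -(prednK w0) -[X in iota 1 X]addn1 iotaD count_cat c0 /=.
by case: cutS => /=; lia.
Qed.

(** The common form of the three rules with s.1 >= 1, for p (+) q (+) r in place of
    sigma (+) omega (+) tau: the new maximum is inserted after p, the top value of p
    is raised above q, and the values of q are lowered by one to fill the gap. The
    step (1,1-j) is the case where q is empty (raising by |q| = 0 changes nothing),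
    and the step (k+2,1) the case where r is empty. *)
Definition raiseS (p q r : seq nat) : seq nat :=
  [seq if v == size p then size p + size q else v | v <- p] ++
  (size p + size q + size r).+1 ::
  [seq v + (size p).-1 | v <- q] ++ [seq v + (size p + size q) | v <- r].

Lemma size_raiseS p q r : size (raiseS p q r) = (size p + size q + size r).+1.
Proof. by rewrite size_cat /= size_cat !size_map addnS addnA. Qed.

Lemma raiseS_nil p r : raiseS p [::] r =
  p ++ (size p + size r).+1 :: [seq v + size p | v <- r].
Proof.
rewrite /raiseS /= addn0; congr (_ ++ _ :: _).
by rewrite -[RHS]map_id; apply: eq_map => v; case: eqP.
Qed.

Lemma permS_raiseS (p q r : seq nat) : permS p -> permS q -> permS r ->
  (q != [::] -> p != [::]) -> permS (raiseS p q r).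
Proof.
move=> pp pq pr; case: (eqVneq q [::]) => [->|q0] p0.
  rewrite raiseS_nil /permS size_cat /= size_map addnS -addn1 iotaD.
  apply/permP => c; rewrite !count_cat /= (permP pp) (permP (perm_iota_shift _ pr)).
  by rewrite iotaD count_cat /= !add1n addn1; lia.
have {p0} : 0 < size p by rewrite lt0n size_eq0 p0.
case sp: (size p) => [//|m] _; rewrite /permS size_raiseS /raiseS sp.
have -> : (m.+1 + size q + size r).+1 = m + size q + 1 + size r + 1 by lia.
have iotaS : iota 1 m.+1 = iota 1 m ++ [:: m.+1] by rewrite -[m.+1 in LHS]addn1 iotaD add1n.
apply/permP => c; rewrite count_cat (permP (perm_map _ pp)) sp iotaS map_cat.
rewrite [count c (_ :: _ ++ _)]/= !count_cat.
rewrite (permP (perm_iota_shift _ pq)) (permP (perm_iota_shift _ pr)).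
rewrite !iotaD !count_cat /= eqxx !add1n.
have -> : [seq if v == m.+1 then m.+1 + size q else v | v <- iota 1 m] = iota 1 m.
  rewrite -[RHS]map_id; apply/eq_in_map => v; rewrite mem_iota => vm.
  by rewrite ifF //; lia.
rewrite !addn1 !addSn; lia.
Qed.


(** The new maximum glues together all that follows p into one block, and the raised
    top value of p glues the last block of p to it when q is nonempty. *)
Lemma block_raiseS (p q r : seq nat) : permS p -> permS q -> permS r ->
  (q != [::] -> p != [::]) -> block (raiseS p q r) = block p + (q == [::]).
Proof.
move=> pp pq pr p0; have pw := permS_raiseS pp pq pr p0.
have le_cut w i v : cutS w i -> v \in take i w -> v <= i.
  by move=> /perm_mem ->; rewrite mem_iota; lia.
(* The new maximum, at index |p|, prevents cuts after it but before the end. *)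
have cut_hi i : size p < i < size (raiseS p q r) -> cutS (raiseS p q r) i = false.
  move=> iw; apply/negP => /le_cut h.
  have : (size p + size q + size r).+1 <= i.
    apply: h; rewrite /raiseS take_cat size_map ltnNge ltnW; last by case/andP: iw.
    rewrite mem_cat -(subnSK (proj1 (andP iw))) /= in_cons eqxx orbT //.
  by move: iw; rewrite size_raiseS; lia.
have -> : block (raiseS p q r) = (count (cutS (raiseS p q r)) (iota 1 (size p))).+1.
  rewrite /block size_raiseS.
  have [t tE] : {t | t = size q + size r} by exists (size q + size r).
  have -> : (size p + size q + size r).+1 = size p + t + 1 by lia.
  rewrite !iotaD !count_cat /= addn0 -addnA -[RHS]addn1; congr (_ + _).
  have -> : count (cutS (raiseS p q r)) (iota (1 + size p) t) = 0.
    apply/eqP; rewrite -leqn0 leqNgt -has_count; apply/hasPn => i.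
    by rewrite mem_iota => ip; rewrite cut_hi //; rewrite size_raiseS; lia.
  have -> : 1 + (size p + t) = size (raiseS p q r) by rewrite size_raiseS; lia.
  by rewrite /cutS take_size; move: pw; rewrite /permS => ->.
case: (eqVneq q [::]) => [qE|q0].
  rewrite addn1 /block; congr _.+1; apply: eq_in_count => i; rewrite mem_iota => ip.
  by rewrite /cutS qE raiseS_nil takel_cat //; lia.
have {p0} : 0 < size p by rewrite lt0n size_eq0 p0.
rewrite addn0 /block; case sp: (size p) => [//|m] _.
rewrite -[m.+1]addn1 iotaD !count_cat /= addn0 add1n -sp.
have -> : cutS p (size p) by rewrite /cutS take_size.
have -> : cutS (raiseS p q r) (size p) = false.
  apply/negP => /le_cut h; have : size p + size q <= size p.
    apply: h; rewrite /raiseS take_size_cat ?size_map //.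
    apply/mapP; exists (size p); last by rewrite eqxx.
    by rewrite permS_mem // sp /=.
  by rewrite -{2}[size p]addn0 leq_add2l leqn0 size_eq0 (negPf q0).
rewrite /= addn0 addn1; congr _.+1; apply: eq_in_count => i; rewrite mem_iota => ip.
have lt_i : i < size p by rewrite sp; lia.
rewrite /raiseS /cutS takel_cat ?size_map 1?ltnW // -map_take.
have id_on : (size p \notin take i p) ->
  [seq if v == size p then size p + size q else v | v <- take i p] = take i p.
  move=> h; rewrite -[RHS]map_id; apply/eq_in_map => v vi.
  by rewrite ifF //; apply/eqP => vE; rewrite -vE vi in h.
have [h|h] := boolP (size p \in take i p); last by rewrite id_on.
have -> : perm_eq (take i p) (iota 1 i) = false.
  by apply/negP => c; have := le_cut _ _ _ c h; lia.
apply/negP => /perm_mem c.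
have : size p + size q \in iota 1 i.
  by rewrite -c; apply/mapP; exists (size p) => //; rewrite eqxx.
by rewrite mem_iota; lia.
Qed.

(** The graph of the recursive rule, with the decomposition as data. The summand
    (q == [::]) in the condition on s reconciles the rules: b = 1 - j with
    block(r) = j + 1 when q is empty, and b = -j or b = 1 otherwise. *)
Variant stepS_spec (w : seq nat) (s : step) : seq nat -> Prop :=
| StepSadd of s = (0, 1)%R : stepS_spec w s (dsumS w [:: 1])
| StepSraise p q r of permS p & permS q & permS r & w = dsumS p (dsumS q r)
    & (q != [::] -> p != [::]) & (q = [::] -> r != [::])
    & s = ((block q)%:Z + 1, 1 - (block r)%:Z + (q == [::] : nat)%:Z)%R :
    stepS_spec w s (raiseS p q r).

Lemma nth_raiseS p q r i : i <= size p + size q + size r ->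
  nth 0 (raiseS p q r) i =
    if i < size p then if nth 0 p i == size p then size p + size q else nth 0 p i
    else if i == size p then (size p + size q + size r).+1
    else if i <= size p + size q then nth 0 q (i - (size p).+1) + (size p).-1
    else nth 0 r (i - (size p + size q).+1) + (size p + size q).
Proof.
move=> iw; rewrite /raiseS nth_cat size_map; case: ltnP => ip; first by rewrite (nth_map 0).
case: eqP => [->|/eqP ip']; first by rewrite subnn.
have {ip'} ip : size p < i by rewrite ltn_neqAle eq_sym ip' ip.
have -> : i - size p = (i - (size p).+1).+1 by lia.
rewrite /= nth_cat size_map; case: ltnP => iq.
  by rewrite (nth_map 0) // ifT //; lia.
rewrite ifF; last by lia.
rewrite (nth_map 0); last by lia.
by congr (nth _ _ _ + _); lia.
Qed.

Lemma nth_dsumS3 p q r i : i < size p + size q + size r ->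
  nth 0 (dsumS p (dsumS q r)) i =
    if i < size p then nth 0 p i
    else if i < size p + size q then nth 0 q (i - size p) + size p
    else nth 0 r (i - (size p + size q)) + (size p + size q).
Proof.
move=> iw; rewrite /dsumS nth_cat; case: ltnP => // ip.
rewrite (nth_map 0); last by rewrite size_cat size_map; lia.
rewrite nth_cat; case: (ltnP i (size p + size q)) => iq.
  by rewrite ifT //; lia.
rewrite ifF; last by lia.
rewrite (nth_map 0); last by lia.
by rewrite -subnDA -addnA [size q + _]addnC.
Qed.

(** The place y of the rule for [stepS] is where p takes its largest value. *)
Lemma index_dsumS_top p q i : permS p -> p != [::] -> i < size p ->
  (i == index (size p) (dsumS p q)) = (nth 0 p i == size p).
Proof.
move=> pp p0 ip; have sp : size p \in p by rewrite permS_mem // lt0n size_eq0 p0 /=.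
rewrite /dsumS index_cat sp; apply/eqP/eqP => [->|<-]; first by rewrite nth_index.
by rewrite index_uniq // permS_uniq.
Qed.

Lemma nth_iota_map (f : nat -> nat) n i : i < n ->
  nth 0 [seq f i | i <- iota 1 n] i = f i.+1.
Proof. by move=> iN; rewrite (nth_map 0) ?size_iota // nth_iota // add1n. Qed.

(** The relation is functional because the decompositions are unique; what remains
    is to compare entries segment by segment. *)
Lemma stepS_unique w s w' : permS w -> stepS_spec w s w' -> stepS w s = w'.
Proof.
move=> pw; case=> [-> //|p q r pp pq pr wE qp qr ->].
have sw : size w = size p + size q + size r by rewrite wE !size_dsumS addnA.
have nthw := @nth_dsumS3 p q r; rewrite -wE -sw in nthw.
have bq : (block q == 0) = (q == [::]) by apply: block_eq0.
have zw : ssplit (block r) w = size p + size q.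
  by rewrite wE dsumSA ssplit_block ?permS_dsumS // size_dsumS.
rewrite /stepS.
have -> : ((block q)%:Z + 1 == 0 :> int)%R = false by lia.
case: (eqVneq q [::]) => [qE|q0] in bq qp qr *.
  have sq : size q = 0 by rewrite qE.
  have -> : ((block q)%:Z + 1 == 1 :> int)%R by lia.
  have br := block_gt0 pr (qr qE).
  have -> : `|(1 - (1 - (block r)%:Z + (true : nat)%:Z))%R|.+1 = block r by lia.
  rewrite zw sq addn0; apply: (@eq_from_nth _ 0) => [|i].
    by rewrite size_map size_iota size_raiseS sw sq.
  rewrite size_map size_iota => iw; rewrite nth_iota_map //.
  rewrite nth_raiseS -?sw // sq addn0 ltnS eqSS /=.
  case: (ltngtP i (size p)) => ip //.
    rewrite nthw; last by lia.
    by rewrite ip; case: eqP => // ->.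
  rewrite nthw; last by lia.
  rewrite sq addn0 ifF; last by lia.
  rewrite ifF; last by lia.
  by congr (nth _ _ _ + _); lia.
have p0 := qp isT; have bq0 := block_gt0 pq q0.
have -> : ((block q)%:Z + 1 == 1 :> int)%R = false by lia.
have -> : `|((block q)%:Z + 1 - 2)%R|.+1 = block q by lia.
have entry i : i <= size w ->
  (if i.+1 == (index (size p) w).+1 then size p + size q
   else if i.+1 < (size p).+1 then nth 0 w i
   else if i.+1 == (size p).+1 then (size w).+1
   else if i.+1 <= (size p + size q).+1 then (nth 0 w i.-1).-1
   else nth 0 w i.-1) = nth 0 (raiseS p q r) i.
  move=> iw; rewrite nth_raiseS -?sw // !ltnS !eqSS.
  have idx : index (size p) w < size p.
    have sp : size p \in p by rewrite permS_mem // lt0n size_eq0 p0 /=.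
    by rewrite wE /dsumS index_cat sp index_mem.
  case: (ltngtP i (size p)) => ip.
  - by rewrite wE index_dsumS_top // -wE nthw ?ip //; lia.
  - have -> : (i == index (size p) w) = false by lia.
    rewrite nthw; last by lia.
    have -> : (i.-1 < size p) = false by lia.
    case: (leqP i (size p + size q)) => iq.
      have -> : i.-1 < size p + size q by lia.
      by have -> : i.-1 - size p = i - (size p).+1; lia.
    have -> : (i.-1 < size p + size q) = false by lia.
    by congr (nth _ _ _ + _); lia.
  - by rewrite ifF //; lia.
case: (eqVneq r [::]) => [rE|r0].
  have sr : size r = 0 by rewrite rE.
  have -> : (1 - (block r)%:Z + (false : nat)%:Z == 1 :> int)%R by rewrite rE.
  have -> : ssplit (block q) w = size p by rewrite wE rE dsumS0 ssplit_block.
  apply: (@eq_from_nth _ 0) => [|i]; first by rewrite size_map size_iota size_raiseS sw.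
  rewrite size_map size_iota => iw; rewrite nth_iota_map // -entry //.
  have -> : size p + size q = size w by rewrite sw sr addn0.
  by rewrite iw.
have br0 := block_gt0 pr r0.
have -> : (1 - (block r)%:Z + (false : nat)%:Z == 1 :> int)%R = false by lia.
have -> : `|(1 - (block r)%:Z + (false : nat)%:Z)%R|.+1 = block r by lia.
rewrite zw.
have -> : take (size p + size q) w = dsumS p q.
  by rewrite wE dsumSA -size_dsumS /dsumS take_size_cat.
rewrite ssplit_block //.
apply: (@eq_from_nth _ 0) => [|i]; first by rewrite size_map size_iota size_raiseS sw.
by rewrite size_map size_iota => iw; rewrite nth_iota_map // -entry.
Qed.

Lemma stepS_specP w s : permS w -> inF s -> (s.1 - s.2 < (block w)%:Z)%R ->
  stepS_spec w s (stepS w s).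
Proof.
move=> pw Fs hs; suff [w' sp] : exists w', stepS_spec w s w'.
  by rewrite (stepS_unique pw sp).
case: s Fs hs => a b Fs /= hs; case: (inFP Fs) => [[-> ->]|[/= a1 b1]].
  by eexists; apply: StepSadd.
case: (eqVneq a 1%R) => a1'.
  have [|p [r [pp pr br wE]]] := @ssplit_exists `|(2 - b)%R|%N w pw; first by lia.
  eexists; apply: (@StepSraise _ _ p [::] r) => //; first by rewrite dsum0S.
    by move=> _; apply/eqP => rE; move: br; rewrite rE /block /=; lia.
  rewrite a1' -[block [::]]/0 eqxx /=; congr (_, _); lia.
have [|u [r [pu pr br wE]]] := @ssplit_exists `|(1 - b)%R|%N w pw; first by lia.
have bw : block w = block u + block r by rewrite wE block_cat.
have [|p [q [pp pq bq uE]]] := @ssplit_exists `|(a - 1)%R|%N u pu; first by lia.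
have bu : block u = block p + block q by rewrite uE block_cat.
have q0 : q != [::] by rewrite -block_eq0 //; lia.
eexists; apply: (@StepSraise _ _ p q r) => //; first by rewrite dsumSA -uE.
- by move=> _; rewrite -block_eq0 //; lia.
- by move=> qE; rewrite qE in q0.
by rewrite (negPf q0); congr (_, _); lia.
Qed.

(** The values of u stay below the top value of u (+) p, except when p is empty, in
    which case q is empty as well and nothing is raised. *)
Lemma raiseS_dsumS (u p q r : seq nat) : permS u -> (q != [::] -> p != [::]) ->
  raiseS (dsumS u p) q r = dsumS u (raiseS p q r).
Proof.
move=> pu qp; rewrite /raiseS size_dsumS [in LHS]/dsumS map_cat -catA.
rewrite [in RHS]/dsumS map_cat /= map_cat -!map_comp; congr (_ ++ (_ ++ _ :: _ ++ _)).
- rewrite -[RHS]map_id; apply/eq_in_map => v; rewrite (permS_mem _ pu) => vu.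
  case: eqP => // vE; case: (eqVneq q [::]) => [->|/qp p0]; first by rewrite addn0.
  by move: vu; rewrite vE -{3}[size u]addn0 leq_add2l leqn0 size_eq0 (negPf p0) andbF.
- by apply: eq_map => v /=; rewrite (addnC v) eqn_add2l; case: eqP => _; lia.
- by lia.
- case: (eqVneq q [::]) => [-> //|/qp]; rewrite -size_eq0.
  case: (size p) => // n _; apply: eq_map => v /=.
  by rewrite addnS /= -addnA (addnC n).
by apply: eq_map => v /=; lia.
Qed.

(** The summand u is absorbed by the leftmost factor p. *)
Lemma stepS_dsumS u w s w' : permS u -> stepS_spec w s w' ->
  stepS_spec (dsumS u w) s (dsumS u w').
Proof.
move=> pu [->|p q r pp pq pr -> qp qr sE].
  by rewrite dsumSA; apply: StepSadd.
rewrite -raiseS_dsumS // dsumSA; apply: StepSraise => //; first exact: permS_dsumS.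
by move/qp; case: (p) => // v t _; rewrite /dsumS; case: (u).
Qed.

Lemma stepS_block w s w' : permS w -> stepS_spec w s w' ->
  permS w' /\ ((block w')%:Z = (block w)%:Z + s.2 - s.1)%R.
Proof.
move=> pw [->|p q r pp pq pr -> qp qr ->].
  by rewrite permS_dsumS // block_cat //; split=> //=; rewrite {2}/block /=; lia.
rewrite permS_raiseS // block_raiseS // !block_cat ?permS_dsumS //; split=> //=.
by lia.
Qed.

Lemma psiS_block Q : Fpath Q -> permS (psiS Q) /\ ((block (psiS Q))%:Z = ht Q + 1)%R.
Proof.
move: Q; apply: Fpath_ind => [|Q s FQ Fs h [pQ bQ]].
  by rewrite /ht endpoint_nil /block.
rewrite ht_rcons /psiS foldl_rcons -/(psiS Q).
have [|pw ->] := stepS_block pQ (_ : stepS_spec _ s (stepS (psiS Q) s)).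
  by apply: stepS_specP => //; rewrite bQ; lia.
by split=> //; rewrite bQ; lia.
Qed.

Lemma psiS_dsumF Q R : Fpath Q -> Fpath R ->
  psiS (dsumF Q R) = dsumS (psiS Q) (psiS R).
Proof.
apply: foldl_dsumF => [{}Q FQ //|{}Q {}R s FQ FR Fs h].
rewrite -/(psiS Q) -/(psiS R); have [pQ _] := psiS_block FQ; have [pR bR] := psiS_block FR.
apply: stepS_unique; first exact: permS_dsumS.
by apply/stepS_dsumS/stepS_specP; rewrite ?bR //; lia.
Qed.

(** * The decomposition theorem *)

Lemma psi_dsumF (A : fam) Q R : Fpath Q -> Fpath R ->
  psi A (dsumF Q R) = dsum (psi A Q) (psi A R).
Proof.
case: A => FQ FR.
- exact: psiP_dsumF.
- exact: psiB_dsumF.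
- exact: psiS_dsumF.
- exact: psiI_dsumF.
- exact: psiJ_dsumF.
- exact: psiT_dsumF.
Qed.

Theorem proposition7p9 (k : nat) (Q : seq step) (Qs : k.+1.-tuple (seq step)) :
  Fpath Q -> ht Q = k%:Z%R ->
  (forall i : 'I_k.+1, Fpath (tnth Qs i) /\ ht (tnth Qs i) = 0%R) ->
  Q = dsums dsumF Qs ->
  forall A : fam,
    psi A Q = dsums (@dsum A) [tuple of map (psi A) Qs].
Proof.
move=> _ _ FQs -> A.
apply: (foldl_morph_in Fpath_dsumF (@psi_dsumF A)) => i.
by have [] := FQs i.
Qed.
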